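(* For every $\epsilon>0$ there is a constant $C=C(\epsilon)$ such that the following holds. Let $G=(V,E)$ be a graph as in the context on $n$ vertices, let $r\ge 2$ be an integer, let $\phi_{SDP}$ be the optimum value of the $(r+3)$-round Lasserre relaxation of uniform sparsest cut for $G$, and let $X_u=x_u-\frac1n\sum_{v}x_v$ ($u\in V$) be the shifted vectors of an optimal solution, with $X$ the matrix whose columns are the $X_u$. If every subset of at most $2n/r$ vertices of $G$ has sparsity at least $C\,\phi_{SDP}\sqrt{\log n\log r}$, then there exists a set $S\subseteq V$ of $r$ vertices such that $\|X_S^\perp X\|_F^2\le \epsilon\|X\|_F^2$.
   Context: $G=(V,E)$ is an undirected graph on $n$ vertices with edge capacities $C_{uv}=c_{(u,v)}\ge 0$, regular with normalized degree 1, i.e. $\sum_j c_{(i,j)}=1$ for all $i$. For $A,B\subseteq V$, $E(A,B)=\sum_{i\in A,j\in B}c_{(i,j)}$. The sparsity of $S$ is $\phi(S)=\frac{n\,E(S,V\setminus S)}{|S|(n-|S|)}$, and $\phi_{sparsest}=\min_S\phi(S)$. Lasserre relaxation: for an integer $t\ge0$, a family of vectors lies in $\mathrm{Las}_t(V)$ if for every $S\subseteq V$ with $|S|\le t+1$ and every $f\in\{0,1\}^S$ there is a vector $x_S(f)$ in a fixed finite-dimensional real space such that: $\|x_\emptyset\|^2=1$; $\langle x_S(f),x_T(g)\rangle=0$ whenever $f,g$ disagree on some $u\in S\cap T$; $\langle x_S(f),x_T(g)\rangle=\langle x_A(f'),x_B(g')\rangle$ whenever $S\cup T=A\cup B$ and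 $f\circ g=f'\circ g'$ (where $f\circ g$ is the labeling of $S\cup T$ agreeing with $f$ and $g$); and $\|x_{\{u\}}(0)\|^2+\|x_{\{u\}}(1)\|^2=\|x_\emptyset\|^2$ for all $u$. Write $x_u=x_{\{u\}}(1)$. The $t$-round Lasserre relaxation of uniform sparsest cut is: minimize $\frac{1}{n\mu(1-\mu)}\sum_{u<v}C_{uv}\|x_u-x_v\|^2$ over $\mu\in\{1/n,2/n,\dots,1/2\}$ and $x\in\mathrm{Las}_t(V)$ with $\frac1n\sum_u x_u=\mu x_\emptyset$; its optimum value is denoted $\phi_{SDP}$ (so $\phi_{SDP}\le\phi_{sparsest}$). For $S\subseteq V$, $X_S^\perp$ denotes the orthogonal projection onto the orthogonal complement of $\mathrm{span}\{X_u:u\in S\}$, and $\|X_S^\perp X\|_F^2=\sum_u\|X_S^\perp X_u\|^2$, $\|X\|_F^2=\sum_u\|X_u\|^2$.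
   Formalization: Assumes r ≤ n and that every nonempty proper subset of at most 2n/r vertices has positive sparsity (automatic if φ_SDP > 0); without the latter it fails when φ_SDP = 0, e.g. for a perfect matching with r = 2 and large n divisible by 4. *)

(* Defs.v *)
From HB Require Import structures.
From mathcomp Require Import all_boot all_order all_algebra.
From mathcomp Require Import classical_sets reals exp.

Set Implicit Arguments.
Unset Strict Implicit.
Unset Printing Implicit Defensive.

Import Order.TTheory GRing.Theory Num.Theory.
Local Open Scope ring_scope.

Section Graph.
Variables (R : realType) (n : nat).
Implicit Types (c : 'I_n -> 'I_n -> R) (A B : {set 'I_n}).

Definition regular_capacity c : Prop :=
  [/\ forall i j, c i j = c j i,
      forall i j, 0 <= c i j
    & forall i, \sum_j c i j = 1].

Definition edge_weight c A B : R := \sum_(i in A) \sum_(j in B) c i j.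

(* Meaningful only for A nonempty and proper: otherwise it is 0 / 0 = 0. *)
Definition sparsity c A : R :=
  n%:R * edge_weight c A (~: A) / (#|A|%:R * (n%:R - #|A|%:R)).

End Graph.

Section Euclidean.
Variables (R : realType) (d : nat).
Implicit Types u v : 'rV[R]_d.

Definition inner u v : R := \sum_i u 0 i * v 0 i.

Definition sqnorm u : R := inner u u.

(* The rows of [kermx W^T] span the orthogonal complement of the row space
   of W; over the reals it is in direct sum with W, so [proj_mx] is the
   orthogonal projection. *)
Definition proj_perp (W : 'M[R]_d) u : 'rV[R]_d :=
  u *m proj_mx (kermx W^T) W.

End Euclidean.

Section PartialLabelings.
Variable n : nat.

(* A pair (S, f) with f in {0,1}^S is encoded as the partial function equal to
   [Some (f u)] on S and to [None] elsewhere. *)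
Definition plabel := {ffun 'I_n -> option bool}.

Implicit Types f g : plabel.

Definition pdom f : {set 'I_n} := [set u | f u != None].

Definition pempty : plabel := [ffun=> None].

Definition psingle (u : 'I_n) (b : bool) : plabel :=
  [ffun v => if v == u then Some b else None].

Definition pdisagree f g : Prop :=
  exists u, [/\ u \in pdom f, u \in pdom g & f u != g u].

(* The labeling f o g of the union of the two domains; used only when f and g
   do not disagree. *)
Definition pmerge f g : plabel :=
  [ffun u => if f u is Some b then Some b else g u].

End PartialLabelings.

Section Lasserre.
Variables (R : realType) (n d : nat).
Implicit Types (c : 'I_n -> 'I_n -> R) (x : plabel n -> 'rV[R]_d).

(* The values of x on labelings of more than t + 1 vertices are unconstrained
   and irrelevant. *)
Definition Las (t : nat) x : Prop :=
  [/\ sqnorm (x (pempty n)) = 1,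
      forall f g, (#|pdom f| <= t.+1)%N -> (#|pdom g| <= t.+1)%N ->
        pdisagree f g -> inner (x f) (x g) = 0,
      forall f g f' g',
        (#|pdom f| <= t.+1)%N -> (#|pdom g| <= t.+1)%N ->
        (#|pdom f'| <= t.+1)%N -> (#|pdom g'| <= t.+1)%N ->
        ~ pdisagree f g -> ~ pdisagree f' g' -> pmerge f g = pmerge f' g' ->
        inner (x f) (x g) = inner (x f') (x g')
    & forall u, sqnorm (x (psingle u false)) + sqnorm (x (psingle u true))
                = sqnorm (x (pempty n))].

Definition vtx x (u : 'I_n) : 'rV[R]_d := x (psingle u true).

Definition feasible (t : nat) (mu : R) x : Prop :=
  [/\ exists k : nat, [/\ (0 < k)%N, (2 * k <= n)%N & mu = k%:R / n%:R],
      Las t x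
    & n%:R^-1 *: \sum_u vtx x u = mu *: x (pempty n)].

Definition objective c (mu : R) x : R :=
  (n%:R * mu * (1 - mu))^-1 *
  \sum_(u < n) \sum_(v < n | (u < v)%N) c u v * sqnorm (vtx x u - vtx x v).

Definition shifted x (u : 'I_n) : 'rV[R]_d :=
  vtx x u - n%:R^-1 *: \sum_v vtx x v.

Definition span_of (X : 'I_n -> 'rV[R]_d) (S : {set 'I_n}) : 'M[R]_d :=
  (\sum_(u in S) <<X u>>)%MS.

Definition frob_sq (X : 'I_n -> 'rV[R]_d) : R := \sum_u sqnorm (X u).

Definition residual_sq (X : 'I_n -> 'rV[R]_d) (S : {set 'I_n}) : R :=
  frob_sq (fun u => proj_perp (span_of X S) (X u)).

End Lasserre.

(* The dimension of the ambient Euclidean space is not bounded in advance. *)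
Definition phi_SDP (R : realType) (n t : nat) (c : 'I_n -> 'I_n -> R) : R :=
  inf [set z : R | exists (d : nat) (mu : R) (x : plabel n -> 'rV[R]_d),
         feasible t mu x /\ z = objective c mu x]%classic.

Definition optimal (R : realType) (n d t : nat) (c : 'I_n -> 'I_n -> R)
    (mu : R) (x : plabel n -> 'rV[R]_d) : Prop :=
  feasible t mu x /\ objective c mu x = phi_SDP t c.

(* Main.v *)
(* If many vertices u have few vertices v with |x_u - x_v|^2 small relative to
   |x_u|^2, some set of at most 2n/r vertices is sparse; otherwise a packing of
   dense balls yields at most r - 1 centers which, together with one vertex of
   small norm, are close to almost all of the mass, hence so is their span.

   The sparse set comes from the Arora-Rao-Vazirani theorem.  Normalize the
   vectors as Chlamtac, Makarychev and Makarychev do, with Gram matrix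
   <x_u, x_v> / max(|x_u|^2, |x_v|^2).  For random signs g, a matching of short
   edges along which <g, .> increases by a constant cannot be large: the maximum
   of <g, x_v - x_u> over a ball of radius k D around u has variance O(k D), so
   chaining matched edges makes its mean grow linearly in k, against the
   subgaussian bound on a maximum.  Multiplicative weights turn this into
   O(sqrt(log n))-Lipschitz functions F_1, ..., F_T separating each far pair for
   a constant fraction of the indices.  The tensor product over i of the unit
   vectors (sqrt(1 - (tau F_i)^2), tau F_i) then gives a partition of unity by
   squared amplitudes; Hellinger affinity multiplies under tensor products,
   which is why separating far pairs with probability 1 - 1/(6r) costs only a
   further factor sqrt(log r).  Some level set of this partition is sparse. *)
Require Import Defs.
From HB Require Import structures.
From mathcomp Require Import all_boot all_order all_algebra.
From mathcomp Require Import reals sequences exp.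
From mathcomp Require Import ring lra zify.

Set Implicit Arguments.
Unset Strict Implicit.
Unset Printing Implicit Defensive.

Import Order.TTheory GRing.Theory Num.Theory.
Local Open Scope ring_scope.

(** * Averages over random signs *)

Section SignAverage.
Variable R : realType.
Implicit Types (f g : seq bool -> R) (y : nat -> R) (s : seq bool) (n : nat).

(** The chain has length [K] of order sqrt (log n) and step radius [D] of order 1 / K. Then the
    climb over radius K D has constant variance, as small as needed against the gain per step, while
    its mean is at most a small multiple of K and is beaten by K gains. So 1 / D is the factor sqrt
    (log n). The fractions 4/3 < 5/3 < 2 of n / r are tuned together. Disjoint balls of at least
    4n/3r vertices number at most 3r/4, which leaves room for one more center; level sets on at most
    5n/3r vertices fall under the expansion hypothesis for 2n/r; the gap of n/3r vertices must be
    witnessed outside a ball, which an overlap of 1/(6r) per vertex cannot supply. Squared norms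
    vary from vertex to vertex, and the layer-cake identity for min (f u) (f v) deals with this
    twice: it shows that min (1/p u) (1/p v) is a Gram matrix, so the normalized vectors exist, and
    it cuts the weights [p] into indicators that multiply the partition of unity exactly. *)

Fixpoint avg n f : R :=
  if n is m.+1
  then (avg m (fun s => f (true :: s)) + avg m (fun s => f (false :: s))) / 2
  else f [::].

Definition signed_sum n y s : R := \sum_(i < n) (-1) ^+ nth false s i * y i.

Definition norm2 n y : R := \sum_(i < n) y i ^+ 2.

Lemma avg_le n f g :
  (forall s, size s = n -> f s <= g s) -> avg n f <= avg n g.
Proof.
elim: n f g => [|n IH] f g fg /=; first exact: fg.
rewrite ler_pM2r ?invr_gt0 //; apply: lerD; apply: IH => s sz; apply: fg;
  by rewrite /= sz.
Qed.

Lemma eq_avg n f g :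
  (forall s, size s = n -> f s = g s) -> avg n f = avg n g.
Proof.
by move=> fg; apply/le_anti/andP; split; apply: avg_le => s /fg ->.
Qed.

Lemma avg_cst n a : avg n (fun=> a) = a.
Proof. by elim: n => //= n ->; field. Qed.

Lemma avgD n f g : avg n (fun s => f s + g s) = avg n f + avg n g.
Proof. by elim: n f g => //= n IH f g; rewrite !IH; field. Qed.

Lemma avgZ n a f : avg n (fun s => a * f s) = a * avg n f.
Proof. by elim: n f => //= n IH f; rewrite !IH; field. Qed.

Lemma avgB n f g : avg n (fun s => f s - g s) = avg n f - avg n g.
Proof.
by rewrite -(mulN1r (avg n g)) -avgZ -avgD; apply: eq_avg => s _; rewrite mulN1r.
Qed.

Lemma avg_sum (I : Type) (r : seq I) (P : pred I) n (F : I -> seq bool -> R) :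
  avg n (fun s => \sum_(i <- r | P i) F i s) = \sum_(i <- r | P i) avg n (F i).
Proof.
elim: r => [|i r IH].
  by rewrite big_nil -[RHS](avg_cst n); apply: eq_avg => s _; rewrite big_nil.
rewrite big_cons -IH.
case: ifPn => Pi; first rewrite -avgD; apply: eq_avg => s _; rewrite big_cons.
  by rewrite Pi.
by rewrite (negbTE Pi).
Qed.

Lemma avg_neg n f : avg n (fun s => f (map negb s)) = avg n f.
Proof.
elim: n f => //= n IH f.
by rewrite (IH (fun s => f (false :: s))) (IH (fun s => f (true :: s))) addrC.
Qed.

Lemma avg_exists n f : exists s, avg n f <= f s.
Proof.
elim: n f => /= [|n IH] f; first by exists [::].
have [[s ls] [t lt]] := (IH (fun s => f (true :: s)), IH (fun s => f (false :: s))).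
have [le|/ltW le] := lerP (f (true :: s)) (f (false :: t)).
  exists (false :: t); lra.
exists (true :: s); lra.
Qed.

Lemma avg_sqr_ge n f : avg n f ^+ 2 <= avg n (fun s => f s ^+ 2).
Proof.
have : 0 <= avg n (fun s => (f s - avg n f) ^+ 2).
  by rewrite -[X in X <= _](avg_cst n); apply: avg_le => s _; exact: sqr_ge0.
rewrite (@eq_avg _ _ (fun s => f s ^+ 2 + ((- 2 * avg n f) * f s + avg n f ^+ 2))).
  rewrite avgD avgD avgZ avg_cst; nra.
by move=> s _; ring.
Qed.

Lemma norm2_ge0 n y : 0 <= norm2 n y.
Proof. by apply: sumr_ge0 => i _; exact: sqr_ge0. Qed.

Lemma norm2S n y : norm2 n.+1 y = y 0%N ^+ 2 + norm2 n (fun i => y i.+1).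
Proof. by rewrite /norm2 big_ord_recl. Qed.

Lemma signed_sum_cons n y b s :
  signed_sum n.+1 y (b :: s) = (-1) ^+ b * y 0%N + signed_sum n (fun i => y i.+1) s.
Proof. by rewrite /signed_sum big_ord_recl. Qed.

Lemma signed_sum_neg n y s :
  size s = n -> signed_sum n y (map negb s) = - signed_sum n y s.
Proof.
move=> sz; rewrite /signed_sum -sumrN; apply: eq_bigr => i _.
rewrite (nth_map false) ?sz //; case: nth; rewrite ?expr1 ?expr0; ring.
Qed.

Lemma signed_sumB n y y' s :
  signed_sum n (fun i => y i - y' i) s = signed_sum n y s - signed_sum n y' s.
Proof. by rewrite /signed_sum -sumrB; apply: eq_bigr => i _; rewrite mulrBr. Qed.

Lemma signed_sumZ n a y s :
  signed_sum n (fun i => a * y i) s = a * signed_sum n y s.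
Proof.
by rewrite /signed_sum mulr_sumr; apply: eq_bigr => i _; rewrite mulrCA.
Qed.

Lemma avg_signed_sum2 n y : avg n (fun s => signed_sum n y s ^+ 2) = norm2 n y.
Proof.
elim: n y => [|n IH] y; first by rewrite /= /signed_sum /norm2 !big_ord0 expr0n.
rewrite norm2S -IH /= -avgD mulrC -avgZ -[y 0%N ^+ 2](avg_cst n) -avgD.
by apply: eq_avg => s _; rewrite !signed_sum_cons expr0 expr1; field.
Qed.

(** Khintchine's inequality with the Gaussian constant 3: odd cross terms cancel between the two
    values of the first sign. *)
Lemma avg_signed_sum4 n y :
  avg n (fun s => signed_sum n y s ^+ 4) <= 3 * norm2 n y ^+ 2.
Proof.
elim: n y => [|n IH] y.
  by rewrite /= /signed_sum /norm2 !big_ord0 !expr0n mulr0.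
rewrite norm2S /= -avgD mulrC -avgZ.
rewrite (@eq_avg _ _ (fun s => y 0%N ^+ 4 +
  (6 * y 0%N ^+ 2 * signed_sum n (fun i => y i.+1) s ^+ 2
   + signed_sum n (fun i => y i.+1) s ^+ 4))); last first.
  by move=> s _; rewrite !signed_sum_cons expr0 expr1; field.
rewrite !avgD avg_cst avgZ avg_signed_sum2.
have := IH (fun i => y i.+1); set t := norm2 _ _; set z := avg _ _ => le.
have := sqr_ge0 (y 0%N ^+ 2); rewrite -exprM /=; nra.
Qed.

(** The constant 2 in place of the sharp 1/2 allows an elementary proof: (1 - b)(1 + b + 2 b^2) = 1
    + b^2 (1 - 2 b) >= 1 for b <= 1/2 treats small [a], and |a| <= 2 a^2 treats the rest. *)
Lemma cosh_le (a : R) : (expR a + expR (- a)) / 2 <= expR (2 * a ^+ 2).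
Proof.
have small (b : R) : b <= 1 / 2 -> expR b <= 1 + b + 2 * b ^+ 2.
  move=> hb; have h := expR_ge1Dx (- b); rewrite expRN in h.
  have e0 := expR_gt0 b.
  have : (1 - b) * expR b <= 1.
    by rewrite -ler_pdivlMr // div1r.
  move=> h1; rewrite -(@ler_pM2l _ (1 - b)) ; last lra.
  apply: (le_trans h1); nra.
have [ha|ha] := lerP `|a| (1 / 2).
  apply: le_trans (expR_ge1Dx _).
  move: ha; rewrite ler_norml => /andP[h1 h2].
  have h1' : - a <= 1 / 2 by lra.
  have := small a h2; have := small (- a) h1'; rewrite sqrrN; lra.
have big (b : R) : `|b| = `|a| -> expR b <= expR (2 * a ^+ 2).
  move=> hb; rewrite ler_expR (le_trans (ler_norm b)) // hb -real_normK ?num_real //.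
  nra.
have := big a erefl; have := big (- a) (normrN a); lra.
Qed.

Lemma avg_expR n y : avg n (fun s => expR (signed_sum n y s)) <= expR (2 * norm2 n y).
Proof.
elim: n y => [|n IH] y.
  by rewrite /= /signed_sum /norm2 !big_ord0 mulr0.
rewrite norm2S /= mulrDr expRD -avgD mulrC -avgZ.
rewrite (@eq_avg _ _ (fun s => ((expR (y 0%N) + expR (- y 0%N)) / 2) *
    expR (signed_sum n (fun i => y i.+1) s))); last first.
  by move=> s _; rewrite !signed_sum_cons expr0 expr1 mul1r mulN1r !expRD; field.
rewrite avgZ ler_pM ?cosh_le ?IH //.
  by rewrite divr_ge0 ?addr_ge0 ?expR_ge0.
by rewrite -[X in X <= _](avg_cst n); apply: avg_le => s _; exact: expR_ge0.
Qed.

(* Efron-Stein: flipping one sign moves the maximum by at most twice the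
   corresponding coordinate of the maximizing vector. *)
Lemma variance_max (V : Type) n f (t : V -> R) (w : V -> nat -> R)
    (vs : seq bool -> V) (P : V -> Prop) :
  (forall s, P (vs s)) ->
  (forall s, f s = t (vs s) + signed_sum n (w (vs s)) s) ->
  (forall s v, P v -> t v + signed_sum n (w v) s <= f s) ->
  avg n (fun s => f s ^+ 2) - avg n f ^+ 2 <=
    2 * avg n (fun s => norm2 n (w (vs s))).
Proof.
elim: n f t w vs => [|n IH] f t w vs Pvs fvs fmax.
  by rewrite /= subrr mulr_ge0 // norm2_ge0.
have step b : avg n (fun s => f (b :: s) ^+ 2) - avg n (fun s => f (b :: s)) ^+ 2
    <= 2 * avg n (fun s => norm2 n (fun i => w (vs (b :: s)) i.+1)).
  apply: (IH (fun s => f (b :: s)) (fun v => t v + (-1) ^+ b * w v 0%N)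
    (fun v i => w v i.+1) (fun s => vs (b :: s))) => [s|s|s v Pv].
  - exact: Pvs.
  - by rewrite fvs signed_sum_cons addrA.
  - by rewrite -addrA -signed_sum_cons fmax.
have diff : avg n (fun s => (f (true :: s) - f (false :: s)) ^+ 2) <=
    avg n (fun s => 4 * (w (vs (true :: s)) 0%N ^+ 2 + w (vs (false :: s)) 0%N ^+ 2)).
  apply: avg_le => s _.
  have := fmax (true :: s) (vs (false :: s)) (Pvs _).
  have := fmax (false :: s) (vs (true :: s)) (Pvs _).
  rewrite !fvs !signed_sum_cons expr0 expr1.
  set a := w _ 0%N; set b := w _ 0%N => h1 h2.
  set z := (X in X ^+ 2).
  have z1 : z <= - 2 * a by rewrite /z; lra.
  have z2 : - 2 * b <= z by rewrite /z; lra.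
  have [z0|z0] := lerP 0 z; nra.
have := avg_sqr_ge n (fun s => f (true :: s) - f (false :: s)); rewrite avgB.
have := step true; have := step false; move: diff.
rewrite avgZ avgD /=.
have E b : avg n (fun s => norm2 n.+1 (w (vs (b :: s)))) =
    avg n (fun s => w (vs (b :: s)) 0%N ^+ 2) +
    avg n (fun s => norm2 n (fun i => w (vs (b :: s)) i.+1)).
  by rewrite -avgD; apply: eq_avg => s _; rewrite norm2S.
rewrite !E; nra.
Qed.
End SignAverage.

(** * Chaining along matchings *)

Section Chaining.
Variables (R : realType) (I : finType) (N : nat) (y : I -> nat -> R).
Implicit Types (rho : R) (u v : I) (s : seq bool).

Definition dist2 u v : R := norm2 N (fun i => y u i - y v i).

Local Notation G u s := (signed_sum N (y u) s).

Hypothesis dist2_tri : forall u v w, dist2 u w <= dist2 u v + dist2 v w.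

Lemma dist2_ge0 u v : 0 <= dist2 u v.
Proof. exact: norm2_ge0. Qed.

Lemma dist2xx u : dist2 u u = 0.
Proof. by rewrite /dist2 /norm2 big1 // => i _; rewrite subrr expr0n. Qed.

Lemma dist2C u v : dist2 u v = dist2 v u.
Proof. by apply: eq_bigr => i _; rewrite -sqrrN opprB. Qed.

(** Farthest in the direction [s], not in distance: a fixed choice of maximizer, as [variance_max]
    requires. *)
Definition farthest (rho : R) u s : I :=
  [arg max_(v > u | dist2 u v <= rho) G v s]%O.

Definition climb (rho : R) u s : R := G (farthest rho u s) s - G u s.

Lemma farthest_le rho u s : 0 <= rho -> dist2 u (farthest rho u s) <= rho.
Proof. by move=> r0; rewrite /farthest; case: arg_maxP; rewrite ?dist2xx. Qed.

Lemma climb_ge rho u v s : dist2 u v <= rho -> G v s - G u s <= climb rho u s.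
Proof.
move=> duv; rewrite /climb lerD2r /farthest; case: arg_maxP.
  by rewrite dist2xx (le_trans _ duv) // dist2_ge0.
by move=> k _; apply.
Qed.

(** Since squared distances obey the triangle inequality, the radii [rho] and [D] add; k steps stay
    within squared distance k D, not k^2 D. *)
Lemma climb_step rho D i j s : 0 <= rho -> dist2 i j <= D ->
  climb rho j s + (G j s - G i s) <= climb (rho + D) i s.
Proof.
move=> r0 dij; rewrite /climb addrA subrK; apply: climb_ge.
by apply: le_trans (dist2_tri i j _) _; rewrite addrC lerD ?farthest_le.
Qed.

Lemma climb_variance rho u : 0 <= rho ->
  avg N (fun s => climb rho u s ^+ 2) - avg N (climb rho u) ^+ 2 <= 2 * rho.
Proof.
move=> r0.
apply: (le_trans (@variance_max R I N (climb rho u) (fun=> 0)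
  (fun v i => y v i - y u i) (farthest rho u) (fun v => dist2 u v <= rho) _ _ _)).
- by move=> s; exact: farthest_le.
- by move=> s; rewrite signed_sumB add0r.
- by move=> s v duv; rewrite signed_sumB add0r climb_ge.
rewrite ler_pM2l //.
rewrite -[X in _ <= X](avg_cst N); apply: avg_le => s _.
by rewrite -/(dist2 _ _) dist2C farthest_le.
Qed.

Lemma climb_deviation rho lam u : 0 <= rho -> 0 <= lam -> 2 * rho <= lam ^+ 2 ->
  avg N (fun s => `|climb rho u s - avg N (climb rho u)|) <= lam.
Proof.
move=> r0 l0 rl; rewrite -(@ler_pXn2r _ 2) ?nnegrE //; last first.
  by rewrite -(avg_cst N 0); apply: avg_le => s _.
apply: le_trans (avg_sqr_ge _ _) _; apply: le_trans rl.
apply: le_trans (climb_variance u r0).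
set e := avg N (climb rho u).
rewrite (@eq_avg _ _ _ (fun s => climb rho u s ^+ 2 +
  ((- 2 * e) * climb rho u s + e ^+ 2))).
  rewrite avgD avgD avgZ avg_cst -/e; lra.
by move=> s _; rewrite real_normK ?num_real //; ring.
Qed.

Lemma avg_jensen_expR (f : seq bool -> R) :
  expR (avg N f) <= avg N (fun s => expR (f s)).
Proof.
set m := avg N f.
have -> : expR m = avg N (fun s => expR m * (1 + (f s - m))).
  by rewrite avgZ avgD avgB !avg_cst -/m subrr addr0 mulr1.
apply: avg_le => s _.
have -> : expR (f s) = expR m * expR (f s - m) by rewrite -expRD; congr expR; ring.
by rewrite ler_pM2l ?expR_gt0 // expR_ge1Dx.
Qed.

(** Massart's finite maximal inequality: Jensen moves the average inside the exponential, the
    maximum is at most the sum over the ball, and each summand is subgaussian. *)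
Lemma climb_mean rho lam u : 0 <= rho ->
  lam * avg N (climb rho u) <= ln #|I|%:R + 2 * lam ^+ 2 * rho.
Proof.
move=> r0; have I0 : (0 : R) < #|I|%:R by rewrite ltr0n; apply/card_gt0P; exists u.
rewrite -ler_expR expRD lnK ?posrE // -avgZ.
apply: le_trans (avg_jensen_expR _) _.
apply: (@le_trans _ _ (avg N (fun s => \sum_(v | dist2 v u <= rho)
    expR (signed_sum N (fun i => lam * (y v i - y u i)) s)))).
  apply: avg_le => s _.
  rewrite (bigD1 (farthest rho u s)) /=; last by rewrite dist2C farthest_le.
  rewrite signed_sumZ signed_sumB lerDl; apply: sumr_ge0 => v _.
  exact: expR_ge0.
rewrite avg_sum mulr_natl -sumr_const big_mkcond /=; apply: ler_sum => v _.
case: ifP => [duv|_]; last exact: expR_ge0.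
apply: le_trans (avg_expR _ _) _; rewrite ler_expR -mulrA ler_pM2l //.
suff -> : norm2 N (fun i => lam * (y v i - y u i)) = lam ^+ 2 * dist2 v u.
  by rewrite ler_wpM2l ?sqr_ge0.
by rewrite /norm2 mulr_sumr; apply: eq_bigr => i _; rewrite exprMn.
Qed.

Variables (w : I -> R) (M : seq bool -> I -> I -> R) (D sg lam : R) (K : nat).
Hypothesis D_ge0 : 0 <= D.
Hypothesis M_ge0 : forall s i j, 0 <= M s i j.
Hypothesis M_supp : forall s i j, size s = N -> M s i j != 0 ->
  dist2 i j <= D /\ sg <= G j s - G i s.
Hypothesis M_row : forall s i, \sum_j M s i j <= w i.
Hypothesis M_col : forall s j, \sum_i M s i j <= w j.
Hypothesis M_neg : forall s i j, size s = N -> M (map negb s) j i = M s i j.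
Hypothesis lam_ge0 : 0 <= lam.
Hypothesis lam_ge : 2 * (K%:R * D) <= lam ^+ 2.

Let beta := avg N (fun s => \sum_i \sum_j M s i j).
Let p i := avg N (fun s => \sum_j M s i j).
(** The chaining potential: the mean climb in k steps, each vertex weighted by its expected matched
    mass. *)
Let Phi (k : nat) := \sum_i p i * avg N (climb (k%:R * D) i).

(** Decoupling: the matched mass at a vertex depends on the same signs as its climb, but
    concentration allows the climb to be replaced by its mean at a cost of [W * lam]. *)
Lemma correlation_le (m X : seq bool -> R) (W e : R) :
  (forall s, 0 <= m s <= W) -> avg N (fun s => `|X s - e|) <= lam ->
  `|avg N (fun s => m s * X s) - avg N m * e| <= W * lam.
Proof.
move=> mW dev.
have W0 : 0 <= W by have /andP[a b] := mW [::]; exact: le_trans b.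
have -> : avg N (fun s => m s * X s) - avg N m * e = avg N (fun s => m s * (X s - e)).
  rewrite mulrC -avgZ -avgB; apply: eq_avg => s _; ring.
have bnd s : `|m s * (X s - e)| <= W * `|X s - e|.
  have /andP[m0 m1] := mW s.
  by rewrite normrM (ger0_norm m0) ler_wpM2r.
apply: le_trans (ler_wpM2l W0 dev); rewrite -avgZ ler_norml; apply/andP; split.
  rewrite -mulN1r -avgZ; apply: avg_le => s _; have := bnd s.
  by rewrite ler_norml mulN1r => /andP[].
by apply: avg_le => s _; have := bnd s; rewrite ler_norml => /andP[].
Qed.

(* [M_neg] makes a vertex equally likely to be a lower and an upper endpoint, so
   the same weights [p] occur on both sides and the increments telescope. *)
Lemma chaining_step k : (k < K)%N ->
  Phi k + sg * beta - 2 * (\sum_i w i) * lam <= Phi k.+1.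
Proof.
move=> kK.
have dev (l : nat) i : (l <= K)%N ->
    avg N (fun s => `|climb (l%:R * D) i s - avg N (climb (l%:R * D) i)|) <= lam.
  move=> lK; apply: climb_deviation => //; first by rewrite mulr_ge0.
  by apply: le_trans lam_ge; rewrite ler_pM2l // ler_wpM2r // ler_nat.
have pC i : avg N (fun s => \sum_j M s j i) = p i.
  rewrite /p -avg_neg; apply: eq_avg => s sz.
  by apply: eq_bigr => j _; rewrite M_neg.
have up i : avg N (fun s => (\sum_j M s i j) * climb (k.+1%:R * D) i s) <=
    p i * avg N (climb (k.+1%:R * D) i) + w i * lam.
  have mW s : 0 <= \sum_j M s i j <= w i by rewrite M_row sumr_ge0.
  have := correlation_le mW (dev k.+1 i kK).
  rewrite ler_norml -/(p i) => /andP[_]; lra.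
have lo i : p i * avg N (climb (k%:R * D) i) - w i * lam <=
    avg N (fun s => (\sum_j M s j i) * climb (k%:R * D) i s).
  have mW s : 0 <= \sum_j M s j i <= w i by rewrite M_col sumr_ge0.
  have := correlation_le mW (dev k i (ltnW kK)).
  rewrite ler_norml pC => /andP[]; lra.
have mid : avg N (fun s => (\sum_j (\sum_i M s i j) * climb (k%:R * D) j s)
      + sg * \sum_i \sum_j M s i j) <=
    avg N (fun s => \sum_i (\sum_j M s i j) * climb (k.+1%:R * D) i s).
  apply: avg_le => s sz.
  under eq_bigr do rewrite mulr_suml.
  rewrite exchange_big /= mulr_sumr -big_split /=.
  apply: ler_sum => i _; rewrite mulr_suml mulr_sumr -big_split /=.
  apply: ler_sum => j _.
  have [->|nz] := eqVneq (M s i j) 0; first by rewrite !mul0r mulr0 addr0.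
  have [dij gij] := M_supp sz nz.
  rewrite [sg * _]mulrC -mulrDr; apply: ler_wpM2l => //.
  rewrite -natr1 mulrDl mul1r.
  apply: le_trans (climb_step _ _ dij); last by rewrite mulr_ge0.
  by rewrite lerD2l.
move: mid; rewrite avgD avgZ -/beta !avg_sum => mid.
have := ler_sum (index_enum I) (fun i (_ : true) => up i).
have := ler_sum (index_enum I) (fun i (_ : true) => lo i).
rewrite sumrB big_split /= -mulr_suml -/(Phi k) -/(Phi k.+1); lra.
Qed.

(** [Phi] starts nonnegative, gains a fixed amount in each of [K] steps, and ends at most [beta * B]
    because [p] sums to [beta]. *)
Lemma chaining B : (forall i, avg N (climb (K%:R * D) i) <= B) ->
  K%:R * (sg * beta - 2 * (\sum_i w i) * lam) <= beta * B.
Proof.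
move=> mean.
have p0 i : 0 <= p i.
  by rewrite -[X in X <= _](avg_cst N); apply: avg_le => s _; exact: sumr_ge0.
have Phi_ge k : (k <= K)%N ->
    k%:R * (sg * beta - 2 * (\sum_i w i) * lam) <= Phi k.
  elim: k => [_|k IH kK].
    rewrite mul0r sumr_ge0 // => i _; apply: mulr_ge0; rewrite ?p0 //.
    rewrite -[X in X <= _](avg_cst N); apply: avg_le => s _.
    rewrite mul0r -[X in X <= _](subrr (G i s)).
    by apply: climb_ge; rewrite dist2xx.
  have := IH (ltnW kK); have := chaining_step kK; rewrite -natr1; lra.
apply: le_trans (Phi_ge K (leqnn K)) _.
rewrite /beta avg_sum mulr_suml; apply: ler_sum => i _; exact: ler_wpM2l.
Qed.

End Chaining.

(** * Separating far pairs *)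

Section GreedyMatching.
Variables (R : realType) (I : finType) (w : I -> R).
Hypothesis w_ge0 : forall i, 0 <= w i.

(** A fractional matching in the bipartite double cover: [w] caps rows and columns separately. The
    head edge is served last and takes all capacity left at its two ends. *)
Fixpoint greedy (e : seq (I * I)) (i j : I) : R :=
  if e is (a, b) :: e' then
    greedy e' i j + (if (i == a) && (j == b) then
      Num.min (w a - \sum_k greedy e' a k) (w b - \sum_k greedy e' k b) else 0)
  else 0.

Let row e i := \sum_k greedy e i k.
Let col e j := \sum_k greedy e k j.

Lemma greedy_row_cons a b e i : row ((a, b) :: e) i =
  row e i + (if i == a then Num.min (w a - row e a) (w b - col e b) else 0).
Proof.
rewrite /row /= big_split /=; congr (_ + _).
case: (i == a) => /=; last by rewrite big1.
by rewrite -big_mkcond big_pred1_eq.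
Qed.

Lemma greedy_col_cons a b e j : col ((a, b) :: e) j =
  col e j + (if j == b then Num.min (w a - row e a) (w b - col e b) else 0).
Proof.
rewrite /col /= big_split /=; congr (_ + _).
case: (j == b) => /=; last by rewrite big1 // => k _; rewrite andbF.
by under eq_bigr do rewrite andbT; rewrite -big_mkcond big_pred1_eq.
Qed.

Lemma greedy_le e : (forall i, row e i <= w i) /\ (forall j, col e j <= w j).
Proof.
elim: e => [|[a b] e [IHr IHc]].
  by split=> i; rewrite /row /col /= big1.
split=> i; rewrite ?greedy_row_cons ?greedy_col_cons.
  case: eqP => [->|_]; last by rewrite addr0.
  by rewrite -lerBrDl ge_min lexx.
case: eqP => [->|_]; last by rewrite addr0.
by rewrite -lerBrDl ge_min lexx orbT.
Qed.

Lemma greedy_row e i : \sum_k greedy e i k <= w i.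
Proof. by have [+ _] := greedy_le e; apply. Qed.

Lemma greedy_col e j : \sum_k greedy e k j <= w j.
Proof. by have [_] := greedy_le e; apply. Qed.

Lemma greedy_min_ge0 e a b : 0 <= Num.min (w a - row e a) (w b - col e b).
Proof. by rewrite le_min !subr_ge0 greedy_row greedy_col. Qed.

Lemma greedy_ge0 e i j : 0 <= greedy e i j.
Proof.
elim: e => //= -[a b] e IH; rewrite addr_ge0 //.
by case: ifP => // _; exact: greedy_min_ge0.
Qed.

Lemma greedy_supp e i j : greedy e i j != 0 -> (i, j) \in e.
Proof.
elim: e => [|[a b] e IH] /=; first by rewrite eqxx.
rewrite inE xpair_eqE; case: andb => //=.
by rewrite addr0.
Qed.

(** An edge exhausts one of its ends when it is served, and later edges only add mass. *)
Lemma greedy_maximal e i j : (i, j) \in e ->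
  \sum_k greedy e i k = w i \/ \sum_k greedy e k j = w j.
Proof.
elim: e => // -[a b] e IH; rewrite inE xpair_eqE.
have min0 := greedy_min_ge0 e a b.
have rowS : row e i <= row ((a, b) :: e) i.
  by rewrite greedy_row_cons lerDl; case: ifP.
have colS : col e j <= col ((a, b) :: e) j.
  by rewrite greedy_col_cons lerDl; case: ifP.
case/orP => [/andP[/eqP ia /eqP jb]|/IH [h|h]]; last first.
- right; apply/le_anti/andP; split; first exact: greedy_col.
  by rewrite -[X in X <= _]h.
- left; apply/le_anti/andP; split; first exact: greedy_row.
  by rewrite -[X in X <= _]h.
have [le|/ltW le] := lerP (w a - row e a) (w b - col e b).
  left; rewrite -/(row _ i) greedy_row_cons ia eqxx min_l //; ring.
right; rewrite -/(col _ j) greedy_col_cons jb eqxx min_r //; ring.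
Qed.

End GreedyMatching.

Section SeparatingFunction.
Variables (R : realType) (I : finType) (d : I -> I -> R) (D : R).
Hypothesis D_gt0 : 0 < D.
Hypothesis dxx : forall u, d u u = 0.
Hypothesis d_ge0 : forall u v, 0 <= d u v.
Hypothesis dC : forall u v, d u v = d v u.
Hypothesis d_tri : forall u v w, d u w <= d u v + d v w.
Variables (W : I -> I -> R) (L U : pred I).
Hypothesis W_ge0 : forall u v, 0 <= W u v.

(** The pair weight lost by discarding [u]; using it as matching capacity bounds the loss at
    saturated vertices by the size of the matching. *)
Definition pair_mass u : R := \sum_v (W u v + W v u).
Definition close_edges : seq (I * I) :=
  [seq e <- enum {: I * I} | [&& L e.1, U e.2 & d e.1 e.2 <= D]].
Definition sep_matching : I -> I -> R := greedy pair_mass close_edges.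

Lemma pair_mass_ge0 u : 0 <= pair_mass u.
Proof. by apply: sumr_ge0 => v _; rewrite addr_ge0. Qed.

Lemma sum_pair_mass : \sum_u pair_mass u = 2 * \sum_u \sum_v W u v.
Proof.
rewrite /pair_mass; under eq_bigr do rewrite big_split /=.
by rewrite big_split /= [X in _ + X]exchange_big /= mulr2n mulrDl mul1r.
Qed.

(** Discard the vertices saturated by the matching. By maximality the rest of [L] and the rest of
    [U] are more than [D] apart, so the distance to the rest of [L], divided by [D] and truncated at
    1, separates them. A discarded vertex costs its pair mass, which equals its matched row or
    column mass; each matched edge is thus charged at most twice. *)
Lemma separating_function : exists F : I -> R,
  [/\ forall u, 0 <= F u <= 1,
      forall u v, `|F u - F v| <= d u v / D
    & \sum_u \sum_v W u v * ((L u && U v) || (L v && U u))%:R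
        - 2 * \sum_i \sum_j sep_matching i j
      <= \sum_u \sum_v W u v * (`|F u - F v| == 1)%:R].
Proof.
pose M := sep_matching; pose w := pair_mass.
pose satL u := L u && (\sum_k M u k == w u).
pose satU u := U u && (\sum_k M k u == w u).
pose L' u := L u && ~~ satL u; pose U' u := U u && ~~ satU u.
have far u v : L' u -> U' v -> D < d u v.
  case/andP=> Lu; rewrite /satL Lu /= => nl; case/andP=> Uv.
  rewrite /satU Uv /= => nu; rewrite ltNge; apply/negP => duv.
  have : (u, v) \in close_edges by rewrite mem_filter /= Lu Uv duv mem_enum.
  case/(greedy_maximal pair_mass_ge0) => /eqP h; first by rewrite h in nl.
  by rewrite h in nu.
pose F u := \big[Num.min/1]_(v | L' v) (d u v / D).
have F0 u : 0 <= F u by apply/bigmin_geP; split=> // v _; rewrite divr_ge0 // ltW.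
have F1 u : F u <= 1 by exact: bigmin_le_id.
have lip u v : F u - d u v / D <= F v.
  apply/bigmin_geP; split=> [|x Lx].
    by rewrite (le_trans _ (F1 u)) // gerBl divr_ge0 // ltW.
  rewrite lerBlDr -mulrDl; apply: (@le_trans _ _ (d u x / D)).
    exact: bigmin_le_cond.
  by rewrite ler_pM2r ?invr_gt0 // addrC d_tri.
have FL u : L' u -> F u = 0.
  move=> Lu; apply/le_anti; rewrite F0 andbT.
  by rewrite -[X in _ <= X](mul0r D^-1) -(dxx u); exact: bigmin_le_cond.
have FU u : U' u -> F u = 1.
  move=> Uu; apply/le_anti; rewrite F1 /=; apply/bigmin_geP; split=> // v Lv.
  by rewrite ler_pdivlMr // mul1r dC ltW // far.
exists F; split=> [u|u v|]; first by rewrite F0 F1.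
  rewrite ler_norml; have := lip u v; have := lip v u; rewrite dC; lra.
have pt u v : W u v * ((L u && U v) || (L v && U u))%:R <=
    W u v * (`|F u - F v| == 1)%:R +
    (W u v * (satL u || satU u)%:R + W u v * (satL v || satU v)%:R).
  rewrite -!mulrDr ler_wpM2l // -!natrD ler_nat.
  case su: (satL u || satU u); first by case: (_ || _); rewrite ?addnA ?addn1.
  case sv: (satL v || satU v); first by case: (_ || _); rewrite !addn1.
  move/negbT: su; move/negbT: sv; rewrite !negb_or => /andP[a1 a2] /andP[a3 a4].
  rewrite !addn0; case: orP => // -[/andP[Lx Ux]|/andP[Lx Ux]].
    by rewrite FL ?FU ?sub0r ?normrN1 ?eqxx // /L' /U' ?Lx ?Ux.
  by rewrite (FL v) ?(FU u) ?subr0 ?normr1 ?eqxx // /L' /U' ?Lx ?Ux.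
have sat : \sum_u \sum_v (W u v * (satL u || satU u)%:R +
    W u v * (satL v || satU v)%:R) <= 2 * \sum_i \sum_j M i j.
  under eq_bigr do rewrite big_split /=.
  rewrite big_split /= [X in _ + X]exchange_big /= -big_split /=.
  have -> : 2 * \sum_i \sum_j M i j = \sum_i (\sum_j M i j + \sum_j M j i).
    by rewrite big_split /= [X in _ + X]exchange_big /= mulr2n mulrDl mul1r.
  apply: ler_sum => u _; rewrite -!mulr_suml -mulrDl -big_split /= -/(pair_mass u).
  have s0 : 0 <= \sum_j M u j by apply: sumr_ge0 => j _; exact: greedy_ge0 pair_mass_ge0 _ _ _.
  have s1 : 0 <= \sum_j M j u by apply: sumr_ge0 => j _; exact: greedy_ge0 pair_mass_ge0 _ _ _.
  rewrite /satL /satU; case: orP => [|_]; last by rewrite mulr0 addr_ge0.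
  by rewrite mulr1 -/(w u) => -[] /andP[_ /eqP <-]; rewrite ?lerDl ?lerDr.
rewrite lerBlDr; apply: le_trans (lerD (lexx _) sat).
rewrite -big_split /=; apply: ler_sum => u _.
by rewrite -big_split /=; apply: ler_sum => v _.
Qed.

End SeparatingFunction.

(** * Weighted Arora-Rao-Vazirani separation *)

Section WeightedSeparation.
Variables (R : realType) (I : finType) (N : nat) (y : I -> nat -> R).
Variables (sg : R) (m K : nat) (W : I -> I -> R).

Local Notation d := (dist2 N y).
Local Notation G u s := (signed_sum N (y u) s).

Hypothesis d_tri : forall u v w, d u w <= d u v + d v w.
Hypothesis y_le1 : forall u, norm2 N (y u) <= 1.
Hypothesis sg_gt0 : 0 < sg.
Hypothesis sg_le1 : sg <= 1.
Hypothesis m_large : 7 <= m%:R * sg.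
Hypothesis K_gt0 : (0 < K)%N.
Hypothesis K_large : ln #|I|%:R <= K%:R ^+ 2 :> R.
Hypothesis W_ge0 : forall u v, 0 <= W u v.
Hypothesis W_sum : \sum_u \sum_v W u v = 1.
Hypothesis W_supp : forall u v, W u v != 0 -> 8 * sg ^+ 2 <= d u v.

(** [q] is the splitting probability 1/18 shared among 2m + 1 thresholds, and [D] solves 2 K D = (sg
    q / 32)^2. *)
Let q : R := (18 * (2 * m + 1)%:R)^-1.
Let D : R := sg ^+ 2 * q ^+ 2 / (2048 * K%:R).

(** The k-th threshold is (m - k) sg, with a gap of width [sg] around it; increasing k lowers it. *)
Let lower s k u := G u s + (k%:R - m%:R) * sg <= - (sg / 2).
Let upper s k u := sg / 2 <= G u s + (k%:R - m%:R) * sg.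
Let split s k u v : bool :=
  (lower s k u && upper s k v) || (lower s k v && upper s k u).

Lemma q_gt0 : 0 < q.
Proof. by rewrite invr_gt0 mulr_gt0 // ltr0n addn1. Qed.

Lemma D_gt0 : 0 < D.
Proof. by rewrite divr_gt0 // ?mulr_gt0 ?exprn_gt0 ?q_gt0 ?ltr0n. Qed.

(** Take the least k with v above its gap. By minimality v is less than 3 sg / 2 above that
    threshold, so u, at least 2 sg lower, is below the gap. The bound 7 <= m sg makes the thresholds
    cover [-6, 6]. *)
Lemma threshold_exists s u v :
  2 * sg <= G v s - G u s -> `|G u s| <= 6 -> `|G v s| <= 6 ->
  exists k : 'I_(2 * m + 1), lower s k u && upper s k v.
Proof.
have [[sg0 sg1] mL] := (sg_gt0, sg_le1, m_large).
rewrite !ler_norml => guv /andP[u1 u2] /andP[v1 v2].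
have ex : exists k, upper s k v.
  exists (2 * m)%N; rewrite /upper natrM; nra.
case: (ex_minnP ex) => k up kmin.
have km : (k < 2 * m + 1)%N.
  rewrite addn1 ltnS; apply: kmin; rewrite /upper natrM; nra.
exists (Ordinal km) => /=; rewrite up andbT /lower.
case: k up kmin {km} => [|k] up kmin; first by rewrite sub0r; nra.
have := kmin k; case: (boolP (upper s k v)) => [_ /(_ isT)|]; first by rewrite ltnn.
rewrite /upper -ltNge -[k.+1%:R]natr1 => h _; lra.
Qed.

Lemma split_exists s u v : 2 * sg <= `|G v s - G u s| ->
  `|G u s| <= 6 -> `|G v s| <= 6 -> exists k : 'I_(2 * m + 1), split s k u v.
Proof.
move=> h hu hv; have [le|/ltW le] := lerP 0 (G v s - G u s).
  rewrite ger0_norm // in h; have [k hk] := threshold_exists h hu hv.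
  by exists k; rewrite /split hk.
rewrite ler0_norm // opprB in h; have [k hk] := threshold_exists h hv hu.
by exists k; rewrite /split hk orbT.
Qed.

(* Paley-Zygmund, with an explicit quadratic minorant of the indicator. *)
Lemma split_prob u v : 8 * sg ^+ 2 <= d u v ->
  1 / 18 <= avg N (fun s => \sum_(k < 2 * m + 1) (split s k u v)%:R) :> R.
Proof.
have [[sg0 sg1] mL] := (sg_gt0, sg_le1, m_large).
move=> far; have d0 : 0 < d u v by apply: lt_le_trans far; rewrite mulr_gt0 ?exprn_gt0.
pose Z s := signed_sum N (fun i => y v i - y u i) s.
(* This is 1 - (4/81)(Z^2/d - 5)^2 - (G u)^2/36 - (G v)^2/36, expanded. It is at most 0 when Z^2/d
   <= 1/2, since (9/2)^2 = 81/4, or when a projection exceeds 6. Its mean is at least 1 - (4/81) 18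
   - 2/36 = 1/18, by E Z^2 = d and E Z^4 <= 3 d^2. *)
pose f s := (1 - 4 / 81 * 25) + ((40 / 81 / d u v) * Z s ^+ 2 +
  ((- (4 / 81) / d u v ^+ 2) * Z s ^+ 4 +
   ((- (1 / 36)) * G u s ^+ 2 + (- (1 / 36)) * G v s ^+ 2))).
have ff : 1 / 18 <= avg N f.
  rewrite /f /Z !avgD !avgZ !avg_cst !avg_signed_sum2.
  have := avg_signed_sum4 N (fun i => y v i - y u i).
  have -> : norm2 N (fun i => y v i - y u i) = d u v by rewrite dist2C.
  set z := avg _ _ => z3.
  have -> : 40 / 81 / d u v * d u v = 40 / 81 by field; rewrite gt_eqF.
  have h : - (4 / 81) / d u v ^+ 2 * (3 * d u v ^+ 2) <= - (4 / 81) / d u v ^+ 2 * z.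
    apply: ler_wnM2l z3.
    rewrite mulNr oppr_le0 divr_ge0 //; last exact/exprn_ge0/ltW.
    by rewrite divr_ge0.
  have e : - (4 / 81) / d u v ^+ 2 * (3 * d u v ^+ 2) = - (12 / 81).
    by field; rewrite gt_eqF.
  rewrite e in h; have := y_le1 u; have := y_le1 v; lra.
apply: (le_trans ff); apply: avg_le => s _.
have fE : f s = 1 - 4 / 81 * (Z s ^+ 2 / d u v - 5) ^+ 2 - G u s ^+ 2 / 36 - G v s ^+ 2 / 36.
  by rewrite /f; field; rewrite gt_eqF.
have s0 : 0 <= \sum_(k < 2 * m + 1) (split s k u v)%:R :> R by apply: sumr_ge0.
have [b1|b1] := lerP `|G u s| 6; last first.
  apply: le_trans s0; rewrite fE.
  have : 36 <= G u s ^+ 2 by rewrite -real_normK ?num_real //; nra.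
  have := sqr_ge0 (Z s ^+ 2 / d u v - 5); have := sqr_ge0 (G v s); lra.
have [b2|b2] := lerP `|G v s| 6; last first.
  apply: le_trans s0; rewrite fE.
  have : 36 <= G v s ^+ 2 by rewrite -real_normK ?num_real //; nra.
  have := sqr_ge0 (Z s ^+ 2 / d u v - 5); have := sqr_ge0 (G u s); lra.
have [b3|b3] := lerP (2 * sg) `|G v s - G u s|.
  have [k sk] := split_exists b3 b1 b2.
  apply: (@le_trans _ _ 1).
    rewrite fE; have := sqr_ge0 (Z s ^+ 2 / d u v - 5).
    have := sqr_ge0 (G u s); have := sqr_ge0 (G v s); lra.
  by rewrite (bigD1 k) //= sk lerDl sumr_ge0.
apply: le_trans s0; rewrite fE.
have : Z s ^+ 2 / d u v <= 1 / 2.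
  rewrite ler_pdivrMr // -real_normK ?num_real // /Z signed_sumB.
  have := normr_ge0 (G v s - G u s); nra.
have := sqr_ge0 (G u s); have := sqr_ge0 (G v s); nra.
Qed.

Let M0 s k := sep_matching d D W (lower s k) (upper s k).
(** Averaging over thresholds preserves the capacities. Negating the signs reverses every increment,
    so the swapped second term has the right support and provides the symmetry that [chaining] asks
    for. *)
Let M s i j : R := (2 * (2 * m + 1)%:R)^-1 *
  \sum_(k < 2 * m + 1) (M0 s k i j + M0 (map negb s) k j i).

Lemma matching_small :
  avg N (fun s => \sum_(k < 2 * m + 1) \sum_i \sum_j M0 s k i j) <=
  (2 * m + 1)%:R * (q / 4).
Proof.
have A0 : (0 : R) < (2 * m + 1)%:R by rewrite ltr0n addn1.
have q0 := q_gt0.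
have [[sg0 sg1] mL] := (sg_gt0, sg_le1, m_large).
have M0_ge0 s k i j : 0 <= M0 s k i j.
  exact: (greedy_ge0 (pair_mass_ge0 W_ge0)).
have M_ge0 s i j : 0 <= M s i j.
  apply: mulr_ge0; first by rewrite invr_ge0 mulr_ge0 // ltW.
  by apply: sumr_ge0 => k _; rewrite addr_ge0.
have M0_supp s k i j : M0 s k i j != 0 -> d i j <= D /\ sg <= G j s - G i s.
  move/greedy_supp; rewrite mem_filter => /andP[/= /and3P[lo up dij] _].
  by split=> //; move: lo up; rewrite /lower /upper; lra.
have M_supp s i j : size s = N -> M s i j != 0 -> d i j <= D /\ sg <= G j s - G i s.
  move=> sz; rewrite mulf_eq0 negb_or => /andP[_].
  case: (pickP (fun k : 'I_(2 * m + 1) => (M0 s k i j != 0) || (M0 (map negb s) k j i != 0))) => [k|none].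
    case/orP => [/M0_supp //|/M0_supp[]]; rewrite !signed_sum_neg // dist2C.
    by move=> -> h _; split=> //; move: h; lra.
  rewrite big1 ?eqxx // => k _; have := none k.
  by move/negbT; rewrite negb_or !negbK => /andP[/eqP -> /eqP ->]; rewrite addr0.
have half (z : R) (f g : 'I_(2 * m + 1) -> R) :
    (forall k, f k <= z) -> (forall k, g k <= z) ->
    (2 * (2 * m + 1)%:R)^-1 * \sum_k (f k + g k) <= z.
  move=> fz gz; rewrite mulrC ler_pdivrMr ?mulr_gt0 //.
  have -> : z * (2 * (2 * m + 1)%:R) = \sum_(k < 2 * m + 1) (z + z).
    rewrite sumr_const card_ord -mulr_natl; ring.
  by apply: ler_sum => k _; rewrite lerD.
have M_row s i : \sum_j M s i j <= pair_mass W i.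
  rewrite -mulr_sumr exchange_big /=; under eq_bigr do rewrite big_split /=.
  apply: half => k; first exact: (greedy_row (pair_mass_ge0 W_ge0)).
  exact: (greedy_col (pair_mass_ge0 W_ge0)).
have M_col s j : \sum_i M s i j <= pair_mass W j.
  rewrite -mulr_sumr exchange_big /=; under eq_bigr do rewrite big_split /=.
  apply: half => k; first exact: (greedy_col (pair_mass_ge0 W_ge0)).
  exact: (greedy_row (pair_mass_ge0 W_ge0)).
have M_neg s i j : size s = N -> M (map negb s) j i = M s i j.
  move=> _; rewrite /M (mapK negbK); congr (_ * _).
  by apply: eq_bigr => k _; rewrite addrC.
set S := avg N _.
have betaE : avg N (fun s => \sum_i \sum_j M s i j) = (2 * m + 1)%:R^-1 * S.
  have -> : (2 * m + 1)%:R^-1 * S = (2 * (2 * m + 1)%:R)^-1 * (S + avg N (fun s =>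
      \sum_(k < 2 * m + 1) \sum_i \sum_j M0 (map negb s) k i j)).
    rewrite (avg_neg N (fun s => \sum_(k < 2 * m + 1) \sum_i \sum_j M0 s k i j)).
    have fld (A x : R) : A != 0 -> A^-1 * x = (2 * A)^-1 * (x + x).
      by move=> A_neq0; field.
    by rewrite -/S; apply: fld; rewrite gt_eqF.
  rewrite -avgD -avgZ; apply: eq_avg => s _.
  under eq_bigr do rewrite -mulr_sumr.
  rewrite -mulr_sumr; congr (_ * _).
  rewrite -big_split /=; under eq_bigr do rewrite exchange_big /=.
  rewrite exchange_big /=; apply: eq_bigr => k _.
  under eq_bigr do rewrite big_split /=.
  by rewrite big_split /=; congr (_ + _); rewrite exchange_big.
rewrite leNgt; apply/negP => S_large.
have K0 : (0 : R) < K%:R by rewrite ltr0n.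
have K1 : (1 : R) <= K%:R by rewrite ler1n.
have DE : K%:R * D = sg ^+ 2 * q ^+ 2 / 2048 by rewrite /D; field; rewrite gt_eqF.
(* The total vertex weight is 2, so each step loses 4 lam = sg q / 8, less than half of the gain sg
   b when b > q / 4. *)
pose lam : R := sg * q / 32.
have lam2 : 2 * (K%:R * D) <= lam ^+ 2 by rewrite DE /lam; nra.
have lam0 : 0 <= lam by rewrite divr_ge0 // mulr_ge0 // ltW.
(* This is [climb_mean] at the parameter 4 K / sg: since ln |I| <= K^2, the entropy term costs K sg
   / 4, half of the net gain of at least K sg / 2 per unit of b. *)
pose B := K%:R * sg / 4 + K%:R * sg * q ^+ 2 / 256.
have mean i : avg N (climb N y (K%:R * D) i) <= B.
  have KD0 : 0 <= K%:R * D by rewrite mulr_ge0 // ltW // D_gt0.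
  have := climb_mean N y (4 * K%:R / sg) i KD0.
  set a := avg _ _ => h.
  rewrite -(@ler_pM2l _ (4 * K%:R / sg)); last by rewrite divr_gt0 // mulr_gt0.
  apply: (le_trans h).
  have -> : 4 * K%:R / sg * B = K%:R ^+ 2 + 2 * (4 * K%:R / sg) ^+ 2 * (K%:R * D).
    by rewrite DE /B; field; rewrite gt_eqF.
  by rewrite lerD2r.
have := chaining d_tri (ltW D_gt0) M_ge0 M_supp M_row M_col M_neg lam0 lam2 mean.
rewrite betaE sum_pair_mass W_sum.
set b := _^-1 * S.
have b_large : q / 4 < b by rewrite /b [X in _ < X]mulrC ltr_pdivlMr // mulrC.
apply/negP; rewrite -ltNge /B /lam.
have q1 : q <= 1 / 18.
  have : (2 * m + 1)%:R^-1 <= 1 :> R by rewrite invf_le1 // ler1n addn1.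
  by rewrite /q invfM; lra.
have -> : b * (K%:R * sg / 4 + K%:R * sg * q ^+ 2 / 256) =
   K%:R * (sg * (b * (1 / 4 + q ^+ 2 / 256))) by field.
rewrite ltr_pM2l // .
have -> : sg * b - 2 * (2 * 1) * (sg * q / 32) = sg * (b - q / 8) by field.
have b0 : 0 <= b by lra.
have : b * (q ^+ 2 / 256) <= b * (1 / 256) by apply: ler_wpM2l => //; nra.
by rewrite ltr_pM2l //; lra.
Qed.

Lemma weighted_separation : exists F : I -> R,
  [/\ forall u, 0 <= F u <= 1,
      forall u v, `|F u - F v| <= d u v / D
    & q / 2 <= \sum_u \sum_v W u v * (`|F u - F v| == 1)%:R].
Proof.
have A0 : (0 : R) < (2 * m + 1)%:R by rewrite ltr0n addn1.
pose T s k := \sum_u \sum_v W u v * (split s k u v)%:R - 2 * \sum_i \sum_j M0 s k i j.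
(* 1/18 - 2 (1/72) = 1/36 = (2m + 1) q / 2, so some sign vector and some threshold reach q / 2. *)
have avgT : 1 / 36 <= avg N (fun s => \sum_(k < 2 * m + 1) T s k).
  have -> : avg N (fun s => \sum_(k < 2 * m + 1) T s k) =
     avg N (fun s => \sum_(k < 2 * m + 1) \sum_u \sum_v W u v * (split s k u v)%:R)
     - 2 * avg N (fun s => \sum_(k < 2 * m + 1) \sum_i \sum_j M0 s k i j).
    rewrite -avgZ -avgB; apply: eq_avg => s _.
    by rewrite /T sumrB mulr_sumr.
  have sp : 1 / 18 <= avg N (fun s =>
      \sum_(k < 2 * m + 1) \sum_u \sum_v W u v * (split s k u v)%:R).
    rewrite (@eq_avg _ _ _ (fun s => \sum_u \sum_v W u v *
        \sum_(k < 2 * m + 1) (split s k u v)%:R)); last first.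
      move=> s _; rewrite exchange_big /=; apply: eq_bigr => u _.
      by rewrite exchange_big /=; apply: eq_bigr => v _; rewrite mulr_sumr.
    rewrite avg_sum -[1 / 18]mul1r -[X in X * _ <= _]W_sum mulr_suml.
    apply: ler_sum => u _; rewrite avg_sum mulr_suml; apply: ler_sum => v _.
    rewrite avgZ; have [->|nz] := eqVneq (W u v) 0; first by rewrite !mul0r.
    by apply: ler_wpM2l => //; apply: split_prob; exact: W_supp.
  have := matching_small.
  have -> : (2 * m + 1)%:R * (q / 4) = 1 / 72.
    by rewrite /q; move: ((2 * m + 1)%:R : R) A0 => A A0; field; rewrite gt_eqF.
  lra.
have lt0 : (0 < 2 * m + 1)%N by rewrite addn1.
have [s hs] := avg_exists N (fun s => \sum_(k < 2 * m + 1) T s k).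
have [k hk] : exists k : 'I_(2 * m + 1), q / 2 <= T s k.
  apply/existsP; rewrite -[X in is_true X]negbK negb_exists; apply/negP => /forallP no.
  have : \sum_(k < 2 * m + 1) T s k < \sum_(k < 2 * m + 1) q / 2.
    apply: ltr_sum => [|k _]; last by rewrite ltNge no.
    by apply/hasP; exists (Ordinal lt0); rewrite // mem_index_enum.
  rewrite sumr_const card_ord -[X in _ < X]mulr_natl.
  have -> : (2 * m + 1)%:R * (q / 2) = 1 / 36.
    by rewrite /q; move: ((2 * m + 1)%:R : R) A0 => A A0; field; rewrite gt_eqF.
  by move/(le_lt_trans (le_trans avgT hs)); rewrite ltxx.
have [F [F1 F2 F3]] := separating_function D_gt0 (dist2xx N y) (dist2_ge0 N y)
  (dist2C N y) d_tri (lower s k) (upper s k) W_ge0.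
by exists F; split=> //; apply: le_trans hk F3.
Qed.

End WeightedSeparation.

(** * Soft partitions *)

Section MultiplicativeWeights.
Variables (R : realType) (P : finType) (X : Type).
Variables (good : X -> Prop) (sep : X -> P -> bool) (far : pred P) (c : R).
Hypothesis c_le1 : c <= 1.
Hypothesis some_good : exists x, good x.
Hypothesis oracle : forall W : P -> R, (forall p, 0 <= W p) -> \sum_p W p = 1 ->
  (forall p, W p != 0 -> far p) ->
  exists x, good x /\ c <= \sum_p W p * (sep x p)%:R.

(** A pair loses half of its weight each time it is separated. Asking the oracle about the current
    weights shrinks their total by 1 - c/2 per round, and a single weight is at most the total. *)
Lemma multiplicative_weights T : exists xs : nat -> X, (forall i, good (xs i)) /\
  forall p, far p ->
    (1 / 2) ^+ (\sum_(i < T) sep (xs i) p) <= #|P|%:R * (1 - c / 2) ^+ T.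
Proof.
pose Phi T (xs : nat -> X) : R :=
  \sum_(p | far p) (1 / 2) ^+ (\sum_(i < T) sep (xs i) p).
suff [xs [gxs h]] : exists xs, (forall i, good (xs i)) /\
    Phi T xs <= #|P|%:R * (1 - c / 2) ^+ T.
  exists xs; split=> // p fp; apply: le_trans h; rewrite /Phi (bigD1 p) //= lerDl.
  by apply: sumr_ge0 => i _; rewrite exprn_ge0 // divr_ge0.
have c1 : 0 <= 1 - c / 2 by have := c_le1; lra.
elim: T => [|T [xs [gxs IH]]].
  have [x gx] := some_good; exists (fun=> x); split=> //.
  rewrite expr0 mulr1 /Phi -[X in _ <= X](sumr_const P) big_mkcond /=.
  apply: ler_sum => p _; case: ifP => // _.
  by rewrite big_ord0 expr0.
have wt0 p : 0 <= (1 / 2 : R) ^+ (\sum_(i < T) sep (xs i) p).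
  by rewrite exprn_ge0 // divr_ge0.
have Phi0 : 0 <= Phi T xs by apply: sumr_ge0.
have [x [gx hx]] : exists x, good x /\ c * Phi T xs <=
    \sum_(p | far p) (1 / 2) ^+ (\sum_(i < T) sep (xs i) p) * (sep x p)%:R.
  (* A zero total cannot be normalized to a distribution; any good [x] then works. *)
  have [z|nz] := eqVneq (Phi T xs) 0.
    have [x gx] := some_good; exists x; split=> //; rewrite z mulr0.
    by apply: sumr_ge0 => p _; rewrite mulr_ge0.
  pose W p := (if far p then (1 / 2) ^+ (\sum_(i < T) sep (xs i) p) else 0) / Phi T xs.
  have [p|||x [gx hx]] := @oracle W.
  - by rewrite divr_ge0 //; case: ifP.
  - by rewrite -mulr_suml -big_mkcond divff.
  - by move=> p; rewrite /W; case: ifP => //; rewrite mul0r eqxx.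
  exists x; split=> //.
  have Pp : 0 < Phi T xs by rewrite lt_neqAle eq_sym nz.
  rewrite -ler_pdivlMr // mulr_suml; apply: le_trans hx _.
  rewrite [X in _ <= X]big_mkcond /=; apply: ler_sum => p _.
  by rewrite /W; case: ifP => _; rewrite ?mul0r // mulrAC.
exists (fun i => if i == T then x else xs i); split=> [i|]; first by case: ifP.
have -> : Phi T.+1 (fun i => if i == T then x else xs i) =
    Phi T xs - (\sum_(p | far p) (1 / 2) ^+ (\sum_(i < T) sep (xs i) p) * (sep x p)%:R) / 2.
  rewrite mulr_suml -sumrB; apply: eq_bigr => p _.
  rewrite big_ord_recr /= eqxx; under eq_bigr do rewrite ltn_eqF //.
  rewrite exprD; set a := _ ^+ \sum_(i < T) _.
  by case: (sep x p) => /=; rewrite ?expr1 ?expr0; field.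
rewrite exprSr; apply: (@le_trans _ _ (Phi T xs * (1 - c / 2))); first lra.
by rewrite mulrA ler_wpM2r.
Qed.

End MultiplicativeWeights.

Section Product.
Variables (R : realType) (T : nat).

Lemma one_sub_prod_le (x : 'I_T -> R) : (forall i, 0 <= x i <= 1) ->
  1 - \prod_i x i <= \sum_i (1 - x i).
Proof.
move=> x01; suff [_ h] : 0 <= \prod_i x i <= 1 /\ 1 - \prod_i x i <= \sum_i (1 - x i) by [].
elim/big_rec2: _ => [|i s p _ [/andP[p0 p1] h]]; first by rewrite subrr ler01 lexx.
have /andP[x0 x1] := x01 i; split; last nra.
by rewrite mulr_ge0 // mulr_ile1.
Qed.

Lemma sum_prod_bool (f : 'I_T -> bool -> R) :
  \sum_(z : {ffun 'I_T -> bool}) \prod_i f i (z i) = \prod_i (f i true + f i false).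
Proof.
rewrite -(bigA_distr_bigA f); apply: eq_bigr => i _.
by rewrite big_bool.
Qed.

End Product.

Section SoftPartition.
Variables (R : realType) (I : Type) (T : nat) (F : 'I_T -> I -> R) (tau : R).
Hypothesis tau_ge0 : 0 <= tau.
Hypothesis tau_le : tau <= 1 / 2.
Hypothesis F01 : forall i u, 0 <= F i u <= 1.

Definition amplitude i u (b : bool) : R :=
  if b then tau * F i u else Num.sqrt (1 - (tau * F i u) ^+ 2).

Definition wave (z : {ffun 'I_T -> bool}) u : R := \prod_i amplitude i u (z i).

Definition affinity i u v : R :=
  amplitude i u true * amplitude i v true + amplitude i u false * amplitude i v false.

Let a01 i u : 0 <= tau * F i u <= 1 / 2.
Proof. have /andP[h1 h2] := F01 i u; have := tau_ge0; have := tau_le; nra. Qed.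

Lemma amplitude_sqr i u : amplitude i u true ^+ 2 + amplitude i u false ^+ 2 = 1.
Proof.
have /andP[h1 h2] := a01 i u.
by rewrite /amplitude sqr_sqrtr; [ring | nra].
Qed.

Lemma amplitude_ge0 i u b : 0 <= amplitude i u b.
Proof. by case: b; rewrite /amplitude ?sqrtr_ge0 //; have /andP[] := a01 i u. Qed.

Lemma amplitude_false_ge i u : 1 / 2 <= amplitude i u false.
Proof.
have := amplitude_sqr i u; have := amplitude_ge0 i u false.
have := a01 i u; rewrite -[tau * _]/(amplitude i u true); nra.
Qed.

Lemma affinity_ge0 i u v : 0 <= affinity i u v.
Proof. by rewrite addr_ge0 // mulr_ge0 // amplitude_ge0. Qed.

Lemma affinity_le1 i u v : affinity i u v <= 1.
Proof.
have := amplitude_sqr i u; have := amplitude_sqr i v; rewrite /affinity.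
set a := amplitude i u true; set b := amplitude i v true.
set a' := amplitude i u false; set b' := amplitude i v false.
have := sqr_ge0 (a - b); have := sqr_ge0 (a' - b'); nra.
Qed.

(** For unit vectors (a, a') and (b, b') the left side is ((a - b)^2 + (a' - b')^2) / 2. As |a' -
    b'| (a' + b') = |a - b| (a + b) and, by tau <= 1/2, a + b <= 1 <= a' + b', the second square is
    at most the first. *)
Lemma one_sub_affinity_le i u v :
  1 - affinity i u v <= tau ^+ 2 * (F i u - F i v) ^+ 2.
Proof.
have := amplitude_sqr i u; have := amplitude_sqr i v.
have := amplitude_false_ge i u; have := amplitude_false_ge i v.
have := a01 i u; have := a01 i v.
rewrite -exprMn mulrBr /affinity.
rewrite -[tau * F i u]/(amplitude i u true) -[tau * F i v]/(amplitude i v true).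
move: (amplitude i u true) (amplitude i v true) => a b.
move: (amplitude i u false) (amplitude i v false) => a' b'.
move=> /andP[b0 b1] /andP[a0 a1] b2 a2 ea eb.
have e : (a' - b') ^+ 2 * (a' + b') ^+ 2 = (a - b) ^+ 2 * (a + b) ^+ 2.
  have -> : (a' - b') ^+ 2 * (a' + b') ^+ 2 = (a' ^+ 2 - b' ^+ 2) ^+ 2 by ring.
  have -> : a' ^+ 2 = 1 - a ^+ 2 by lra.
  have -> : b' ^+ 2 = 1 - b ^+ 2 by lra.
  ring.
have h1 : (a - b) ^+ 2 * (a + b) ^+ 2 <= (a - b) ^+ 2.
  by rewrite ler_piMr ?sqr_ge0 //; nra.
have h2 : (a' - b') ^+ 2 <= (a' - b') ^+ 2 * (a' + b') ^+ 2.
  by rewrite ler_peMr ?sqr_ge0 //; nra.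
have : (a' - b') ^+ 2 <= (a - b) ^+ 2 by lra.
nra.
Qed.

(** Values in [0, 1] that differ by 1 are 0 and 1, so the affinity is sqrt (1 - tau^2) <= 1 - tau^2
    / 2. *)
Lemma affinity_separated i u v :
  `|F i u - F i v| = 1 -> affinity i u v <= expR (- (tau ^+ 2 / 2)).
Proof.
move=> sep; apply: le_trans (expR_ge1Dx _).
have := amplitude_sqr i u; have := amplitude_sqr i v; rewrite /affinity.
have := amplitude_ge0 i u false; have := amplitude_ge0 i v false.
rewrite -[amplitude i u true]/(tau * F i u) -[amplitude i v true]/(tau * F i v).
move: (amplitude i u false) (amplitude i v false) => a' b'.
have /andP[u0 u1] := F01 i u; have /andP[v0 v1] := F01 i v.
have t0 := tau_ge0; have t1 := tau_le.
have [[-> ->]|[-> ->]] : (F i u = 0 /\ F i v = 1) \/ (F i u = 1 /\ F i v = 0).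
- move: sep; have [le|/ltW le] := lerP 0 (F i u - F i v).
    by rewrite ger0_norm // => e; right; split; lra.
  by rewrite ler0_norm // => e; left; split; lra.
- rewrite mulr0 mulr1 mul0r expr0n /= => b0 a0 eb ea.
  have {ea} -> : a' = 1 by nra.
  nra.
- rewrite mulr0 mulr1 expr0n /= => b0 a0 eb ea.
  have {eb} -> : b' = 1 by nra.
  nra.
Qed.

Lemma wave_inner u v : \sum_z wave z u * wave z v = \prod_i affinity i u v.
Proof.
rewrite -(sum_prod_bool (fun i b => amplitude i u b * amplitude i v b)).
by apply: eq_bigr => z _; rewrite -big_split.
Qed.

Lemma wave_ge0 z u : 0 <= wave z u.
Proof. by apply: prodr_ge0 => i _; exact: amplitude_ge0. Qed.

Lemma sum_wave_sqr u : \sum_z wave z u ^+ 2 = 1.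
Proof.
under eq_bigr do rewrite expr2; rewrite wave_inner big1 // => i _.
by rewrite /affinity -!expr2 amplitude_sqr.
Qed.

(** Cauchy-Schwarz for the difference and sum of the waves, in the form |p r| <= p^2 / (2 e) + e r^2
    / 2; the two sums contribute e and 2 e. *)
Lemma sum_wave_diff u v e : 0 < e ->
  tau ^+ 2 * \sum_i (F i u - F i v) ^+ 2 <= e ^+ 2 ->
  \sum_z `|wave z u ^+ 2 - wave z v ^+ 2| <= 3 * e.
Proof.
move=> e0 close.
have X : \sum_z (wave z u - wave z v) ^+ 2 <= 2 * e ^+ 2.
  have -> : \sum_z (wave z u - wave z v) ^+ 2 = 2 * (1 - \prod_i affinity i u v).
    transitivity (\sum_z (wave z u ^+ 2 + wave z v ^+ 2 + (- 2) * (wave z u * wave z v))).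
      by apply: eq_bigr => z _; ring.
    by rewrite !big_split /= -mulr_sumr !sum_wave_sqr wave_inner; ring.
  rewrite ler_pM2l //; apply: le_trans close; rewrite mulr_sumr.
  apply: le_trans (one_sub_prod_le _) _.
    by move=> i; rewrite affinity_ge0 affinity_le1.
  by apply: ler_sum => i _; exact: one_sub_affinity_le.
have Y : \sum_z (wave z u + wave z v) ^+ 2 <= 4.
  apply: (@le_trans _ _ (\sum_z (2 * wave z u ^+ 2 + 2 * wave z v ^+ 2))).
    by apply: ler_sum => z _; have := sqr_ge0 (wave z u - wave z v); nra.
  by rewrite big_split /= -!mulr_sumr !sum_wave_sqr; lra.
apply: (@le_trans _ _ (\sum_z ((2 * e)^-1 * (wave z u - wave z v) ^+ 2 +
    e / 2 * (wave z u + wave z v) ^+ 2))).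
  apply: ler_sum => z _; rewrite subr_sqr.
  set p := _ - _; set r := _ + _.
  rewrite -(@ler_pM2l _ (2 * e)) ?mulr_gt0 //.
  have -> : 2 * e * ((2 * e)^-1 * p ^+ 2 + e / 2 * r ^+ 2) = p ^+ 2 + (e * r) ^+ 2.
    by field; rewrite gt_eqF.
  have [h|h] := lerP 0 (p * r).
    rewrite ger0_norm //; have := sqr_ge0 (p - e * r); nra.
  rewrite ltr0_norm //; have := sqr_ge0 (p + e * r); nra.
rewrite big_split /= -!mulr_sumr.
have h1 : (2 * e)^-1 * \sum_z (wave z u - wave z v) ^+ 2 <= e.
  by rewrite mulrC ler_pdivrMr ?mulr_gt0 //; nra.
nra.
Qed.

(** min (a^2) (b^2) <= a b reduces the overlap to the inner product of the waves, which factors over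
    the coordinates. *)
Lemma sum_wave_min u v :
  \sum_z Num.min (wave z u ^+ 2) (wave z v ^+ 2) <=
  expR (- (tau ^+ 2 / 2)) ^+ (\sum_i (`|F i u - F i v| == 1)%R).
Proof.
apply: (@le_trans _ _ (\sum_z wave z u * wave z v)).
  apply: ler_sum => z _; have := wave_ge0 z u; have := wave_ge0 z v.
  rewrite ge_min; have [le|/ltW le] := lerP (wave z u) (wave z v) => v0 u0.
    by apply/orP; left; nra.
  by apply/orP; right; nra.
rewrite wave_inner expr_sum; apply: ler_prod => i _.
rewrite affinity_ge0 /=; case: eqP => [h|_].
  by rewrite expr1 affinity_separated.
by rewrite expr0 affinity_le1.
Qed.

End SoftPartition.

(** * Lipschitz partitions of unity with little overlap between far points *)

Section SoftDecomposition.
Variable R : realType.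

Lemma nat_above (x : R) : 0 <= x -> exists k : nat, [/\ (0 < k)%N, x <= k%:R & k%:R <= x + 1].
Proof.
move=> x0; have /andP[lo hi] := truncn_itv x0.
by exists (Num.truncn x).+1; split=> //; [exact: ltW | rewrite -natr1 lerD2r].
Qed.

Lemma ln2_ge_half : 1 / 2 <= ln 2 :> R.
Proof.
rewrite -ler_expR lnK ?posrE //.
have := expR_ge1Dx (- (1 / 2) : R); rewrite expRN => h.
have e0 := expR_gt0 (1 / 2 : R).
have : 1 / 2 * expR (1 / 2 : R) <= 1 by rewrite -ler_pdivlMr // [X in _ <= X]div1r; lra.
lra.
Qed.

Lemma ln_nat_ge_half (n : nat) : (2 <= n)%N -> 1 / 2 <= ln n%:R :> R.
Proof.
move=> n2; apply: le_trans ln2_ge_half _.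
by rewrite ler_ln ?posrE ?ltr0n ?ler_nat // (leq_trans _ n2).
Qed.

(** Logarithm of the multiplicative-weights bound: 1/2 >= 1/e and 1 - c/2 <= exp (- c/2) give k >= c
    T / 2 - 2 ln n. *)
Lemma count_lower_bound (n T k : nat) (c : R) : (0 < n)%N ->
  2 * ln n%:R <= c * T%:R / 4 -> 0 <= 1 - c / 2 ->
  (1 / 2) ^+ k <= (n * n)%:R * (1 - c / 2) ^+ T -> c * T%:R / 4 <= k%:R.
Proof.
move=> n0 big c0 h.
suff : - k%:R <= 2 * ln n%:R - c * T%:R / 2 by lra.
rewrite -ler_expR expRD.
have -> : expR (2 * ln n%:R) = (n * n)%:R :> R.
  by rewrite expRM_natl lnK ?posrE ?ltr0n // natrM expr2.
have -> : - (c * T%:R / 2) = T%:R * (- (c / 2)) by ring.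
have -> : - k%:R = k%:R * (- 1) :> R by ring.
rewrite !expRM_natl; apply: le_trans (le_trans _ h) _.
  apply: lerXn2r; rewrite ?nnegrE ?expR_ge0 ?divr_ge0 //.
  rewrite expRN div1r lef_pV2 ?posrE ?expR_gt0 //.
  by have := expR_ge1Dx (1 : R).
apply: ler_wpM2l => //; apply: lerXn2r; rewrite ?nnegrE ?expR_ge0 //.
exact: expR_ge1Dx.
Qed.

Lemma soft_decomposition (del : R) : 0 < del -> del <= 1 ->
  exists C : R, 0 < C /\
  forall (I : finType) (N : nat) (y : I -> nat -> R) (L : R), (2 <= #|I|)%N ->
    (forall u v w, dist2 N y u w <= dist2 N y u v + dist2 N y v w) ->
    (forall u, norm2 N (y u) <= 1) -> 0 < L ->
  exists (Z : finType) (g : Z -> I -> R),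
  [/\ forall z u, 0 <= g z u,
      forall u, \sum_z g z u = 1,
      forall u v, \sum_z `|g z u - g z v| <=
        C * Num.sqrt (ln #|I|%:R * L) * dist2 N y u v
    & forall u v, del < dist2 N y u v ->
        \sum_z Num.min (g z u) (g z v) <= expR (- L)].
Proof.
move=> del0 del1.
pose sg := Num.sqrt (del / 8).
have sg2 : sg ^+ 2 = del / 8 by rewrite sqr_sqrtr // divr_ge0 // ltW.
have sg0 : 0 < sg by rewrite sqrtr_gt0 divr_gt0.
have sg1 : sg <= 1 by nra.
have [m [m0 m7 _]] : exists m : nat, [/\ (0 < m)%N, 7 / sg <= m%:R & m%:R <= 7 / sg + 1].
  by apply: nat_above; rewrite divr_ge0 // ltW.
have {}m7 : 7 <= m%:R * sg by rewrite -ler_pdivrMr.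
pose q : R := (18 * (2 * m + 1)%:R)^-1.
have q0 : 0 < q := q_gt0 R m.
have q1 : q <= 1.
  rewrite invf_le1 ?mulr_gt0 ?ltr0n ?addn1 //.
  have : (1 : R) <= (2 * m + 1)%:R by rewrite ler1n addn1.
  by rewrite addn1; lra.
pose c := q / 2.
have c0 : 0 < c by rewrite /c; lra.
have c1 : c <= 1 by rewrite /c; lra.
(* 18432 = 3 * 3 * 2048: a 3 from [sum_wave_diff], a 3 from K <= sqrt l + 1 <= 3 sqrt l, and 2048
   from [D]. *)
exists (18432 * Num.sqrt (8 / c) / (sg ^+ 2 * q ^+ 2)); split.
  by rewrite divr_gt0 ?mulr_gt0 ?sqrtr_gt0 ?divr_gt0 ?exprn_gt0.
move=> I N y L n2 tri y1 L0.
have ln0 := ln_nat_ge_half n2.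
set l := ln _ in ln0 *.
have sq_half : 1 / 2 <= Num.sqrt l.
  by rewrite -(@ler_pXn2r _ 2) ?nnegrE ?sqrtr_ge0 ?divr_ge0 // sqr_sqrtr; nra.
have [K [K0 Kl Ku]] := nat_above (sqrtr_ge0 l).
have Kl2 : l <= K%:R ^+ 2.
  rewrite -[X in X <= _]sqr_sqrtr; last lra.
  by apply: lerXn2r; rewrite ?nnegrE ?sqrtr_ge0.
(* The first term lets [count_lower_bound] apply, the second makes tau <= 1/2. *)
have [T [T0 Tl _]] : exists T : nat, [/\ (0 < T)%N, 8 * l / c + 32 * L / c <= T%:R &
    T%:R <= 8 * l / c + 32 * L / c + 1].
  by apply: nat_above; rewrite addr_ge0 // divr_ge0 ?mulr_ge0 ?(ltW c0) ?(ltW L0) //; lra.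
have Tp : (0 : R) < T%:R by rewrite ltr0n.
have cT : 8 * l + 32 * L <= c * T%:R.
  have -> : 8 * l + 32 * L = c * (8 * l / c + 32 * L / c) by field; rewrite gt_eqF.
  by rewrite ler_pM2l.
pose D : R := sg ^+ 2 * q ^+ 2 / (2048 * K%:R).
have D0 : 0 < D by exact: D_gt0.
pose good (F : I -> R) := (forall u, 0 <= F u <= 1) /\
  forall u v, `|F u - F v| <= dist2 N y u v / D.
have [||xs [gxs xsP]] := @multiplicative_weights R (I * I)%type (I -> R) good
    (fun F p => `|F p.1 - F p.2| == 1) (fun p => del < dist2 N y p.1 p.2) c c1 _ _ T.
- exists (fun=> 0); split=> [u|u v]; first by rewrite lexx ler01.
  by rewrite subrr normr0 divr_ge0 ?dist2_ge0 // ltW.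
- move=> W W0 W1 Wfar.
  have [|||F [F1 F2 F3]] := weighted_separation tri y1 sg0 sg1 m7 K0 Kl2
      (W := fun u v => W (u, v)).
  - by move=> u v; exact: W0.
  - by rewrite pair_bigA -[RHS]W1; apply: eq_bigr => -[].
  - move=> u v /Wfar /= /ltW h; rewrite sg2; apply: le_trans h; lra.
  exists F; split=> //; apply: le_trans F3 _.
  rewrite pair_bigA; by apply: ler_sum => -[].
(* Chosen so that c T / 4 separations, each costing tau^2 / 2 in the exponent, give exactly L. Since
   tau^2 T = 8 L / c, the number [T] of functions drops out of the Lipschitz constant. *)
pose tau := Num.sqrt (8 * L / (c * T%:R)).
have cT0 : 0 < c * T%:R by rewrite mulr_gt0.
have tau2 : tau ^+ 2 = 8 * L / (c * T%:R).
  by rewrite sqr_sqrtr //; apply/ltW/divr_gt0 => //; exact: mulr_gt0.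
have tau0 : 0 <= tau by exact: sqrtr_ge0.
have tau1 : tau <= 1 / 2.
  rewrite -(@ler_pXn2r _ 2) ?nnegrE ?divr_ge0 // tau2 ler_pdivrMr //; lra.
have F01 (i : 'I_T) u : 0 <= xs i u <= 1 by have [] := gxs i.
exists {ffun 'I_T -> bool}, (fun z u => wave (fun i : 'I_T => xs i) tau z u ^+ 2); split.
- by move=> z u; exact: sqr_ge0.
- by move=> u; exact: sum_wave_sqr.
- move=> u v.
  have [d0|d0] := eqVneq (dist2 N y u v) 0.
    rewrite d0 mulr0 big1 // => z _; apply/eqP; rewrite normr_eq0 subr_eq0; apply/eqP.
    congr (_ ^+ 2); apply: eq_bigr => i _; rewrite /amplitude.
    have [_ /(_ u v)] := gxs i; rewrite d0 mul0r normr_le0 subr_eq0 => /eqP -> //.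
  have dp : 0 < dist2 N y u v by rewrite lt_neqAle eq_sym d0 dist2_ge0.
  pose e := Num.sqrt (8 * L / c) / D * dist2 N y u v.
  have e0 : 0 < e by rewrite !mulr_gt0 ?invr_gt0 // sqrtr_gt0 divr_gt0 // mulr_gt0.
  apply: le_trans (sum_wave_diff tau0 tau1 F01 e0 _) _.
    apply: (@le_trans _ _ (tau ^+ 2 * (T%:R * (dist2 N y u v / D) ^+ 2))).
      apply: ler_wpM2l; first exact: sqr_ge0.
      rewrite mulr_natl -[T in X in _ <= X]card_ord -sumr_const; apply: ler_sum => i _.
      rewrite -real_normK ?num_real //; apply: lerXn2r; rewrite ?nnegrE //.
        by rewrite divr_ge0 // ltW.
      by have [_] := gxs i; apply.
    rewrite tau2 /e !exprMn sqr_sqrtr; last by apply/ltW/divr_gt0 => //; exact: mulr_gt0.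
    rewrite le_eqVlt; apply/orP; left; apply/eqP; field.
    by rewrite !gt_eqF.
  rewrite /e mulrA; apply: ler_wpM2r; first exact: ltW.
  have -> : 3 * (Num.sqrt (8 * L / c) / D) =
      3 * 2048 * (Num.sqrt (8 * L / c) * K%:R) / (sg ^+ 2 * q ^+ 2).
    by rewrite /D; field; rewrite !gt_eqF // ltr0n.
  have -> : 8 * L / c = 8 / c * L by ring.
  rewrite sqrtrM; last by rewrite ltW // divr_gt0.
  rewrite (@sqrtrM _ l); last lra.
  have -> : 18432 * Num.sqrt (8 / c) / (sg ^+ 2 * q ^+ 2) * (Num.sqrt l * Num.sqrt L) =
      3 * 2048 * (Num.sqrt (8 / c) * Num.sqrt L * (3 * Num.sqrt l)) / (sg ^+ 2 * q ^+ 2).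
    by field; rewrite !gt_eqF.
  rewrite ler_pM2r ?invr_gt0 ?mulr_gt0 ?exprn_gt0 // ler_pM2l; last lra.
  by apply: ler_wpM2l; [rewrite mulr_ge0 ?sqrtr_ge0 | lra].
- move=> u v far.
  have h := @xsP (u, v) far; rewrite card_prod in h.
  have kT := count_lower_bound (ltnW n2) _ _ h.
  apply: le_trans (sum_wave_min tau0 tau1 F01 u v) _.
  rewrite -expRM_natl ler_expR mulrN lerN2.
  apply: (@le_trans _ _ (c * T%:R / 4 * (tau ^+ 2 / 2))).
    rewrite tau2 le_eqVlt; apply/orP; left; apply/eqP; field.
    by rewrite !gt_eqF.
  apply: ler_wpM2r; first by rewrite divr_ge0 // sqr_ge0.
  by apply: kT; rewrite -?/l; lra.
Qed.
End SoftDecomposition.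

(** * Sparse level sets *)

Section LayerCake.
Variables (R : realType) (I : finType).
Implicit Types (f : I -> R) (s : seq (R * {set I})).

(** Weighted superlevel sets of [f]. By the last clause they lie in the support and are closed
    upward, hence nested. *)
Definition layers f s : Prop :=
  [/\ forall a, a \in s -> 0 <= a.1,
      forall u, f u = \sum_(a <- s) a.1 * (u \in a.2)%:R
    & forall a u v, a \in s -> u \in a.2 -> 0 < f u /\ (f u <= f v -> v \in a.2)].

(** Induction on the support: the least positive value is peeled off as one layer. *)
Lemma layer_cake f : (forall u, 0 <= f u) -> exists s, layers f s.
Proof.
have [k] := ubnP #|[set u | 0 < f u]|; elim: k f => // k IH f card f0.
have [i0 fi0|none] := pickP (fun u => 0 < f u); last first.
  exists [::]; split=> // u; rewrite big_nil; apply/le_anti; rewrite f0 andbT.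
  by rewrite leNgt none.
pose j := [arg min_(i < i0 | 0 < f i) f i]%O.
have [fj jmin] : 0 < f j /\ forall v, 0 < f v -> f j <= f v.
  by rewrite /j; case: arg_minP.
pose f' u := if 0 < f u then f u - f j else 0.
have f'0 u : 0 <= f' u by rewrite /f'; case: ifP => // /jmin; rewrite subr_ge0.
have [] := IH f' _ f'0.
  rewrite -ltnS; apply: leq_trans card; rewrite ltnS; apply: proper_card.
  apply/properP; split.
    by apply/subsetP => u; rewrite !inE /f'; case: ifP; rewrite // ltxx.
  by exists j; rewrite !inE // /f' fj subrr ltxx.
move=> s [s0 sE sC]; exists ((f j, [set u | 0 < f u]) :: s); split.
- by move=> a; rewrite inE => /orP[/eqP -> /=|/s0 //]; exact: ltW.
- move=> u; rewrite big_cons /= -sE inE /f'.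
  case: ifPn => [_|]; first by rewrite mulr1 addrC subrK.
  by rewrite -leNgt mulr0 add0r => h; apply/le_anti; rewrite f0 h.
move=> a u v; rewrite inE => /orP[/eqP -> /=|as_ ua].
  by rewrite !inE => fu; split=> // /(lt_le_trans fu).
have [f'u h] := sC a u v as_ ua.
have fu : 0 < f u by move: f'u; rewrite /f'; case: ifP; rewrite // ltxx.
split=> // fuv; apply: h; rewrite /f' fu (lt_le_trans fu fuv) lerD2r //.
Qed.

Lemma layers_min f s u v : layers f s ->
  \sum_(a <- s) a.1 * ((u \in a.2)%:R * (v \in a.2)%:R) = Num.min (f u) (f v).
Proof.
case=> s0 sE sC.
have main x y : f x <= f y ->
    \sum_(a <- s) a.1 * ((x \in a.2)%:R * (y \in a.2)%:R) = f x.
  move=> fxy; rewrite [RHS]sE big_seq [RHS]big_seq; apply: eq_bigr => a as_.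
  case xa : (x \in a.2); last by rewrite mul0r.
  by have [_ ->] := sC a x y as_ xa; rewrite ?mulr1.
have [le|/ltW le] := lerP (f u) (f v); first exact: main.
by rewrite -(main _ _ le); apply: eq_bigr => a _; rewrite [_%:R * _]mulrC.
Qed.

Lemma layers_dist f s u v : layers f s ->
  \sum_(a <- s) a.1 * `|(u \in a.2)%:R - (v \in a.2)%:R| = `|f u - f v|.
Proof.
move=> [s0 sE sC].
have main x y : f x <= f y ->
    \sum_(a <- s) a.1 * `|(x \in a.2)%:R - (y \in a.2)%:R| = f y - f x.
  move=> fxy; rewrite [f y]sE [f x]sE -sumrB big_seq [RHS]big_seq.
  apply: eq_bigr => a as_; rewrite -mulrBr; congr (_ * _).
  case xa : (x \in a.2).
    by have [_ ->] := sC a x y as_ xa; rewrite // subrr normr0.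
  by rewrite sub0r normrN subr0 ger0_norm.
have [le|/ltW le] := leP (f u) (f v).
  by rewrite main // distrC ger0_norm // subr_ge0.
rewrite ger0_norm ?subr_ge0 // -(main _ _ le); apply: eq_bigr => a _.
by rewrite distrC.
Qed.

Lemma order_statistic f (k : nat) : (0 < k <= #|I|)%N -> exists v,
  (#|[set u | (f v < f u)%R]| < k <= #|[set u | (f v <= f u)%R]|)%N.
Proof.
case/andP=> k0 kI.
have [i0 _] : exists i0 : I, i0 \in I by apply/card_gt0P; exact: leq_trans kI.
pose P v := (k <= #|[set u | (f v <= f u)%R]|)%N.
pose lo := [arg min_(i < i0) f i]%O.
have Plo : P lo.
  rewrite /P; have -> : [set u | f lo <= f u] = setT; last by rewrite cardsT.
  by apply/setP => u; rewrite !inE /lo; case: arg_minP => // i _ ->.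
pose w := [arg max_(i > lo | P i) f i]%O.
have [Pw wmax] : P w /\ forall v, P v -> f v <= f w.
  by rewrite /w; case: arg_maxP.
exists w; rewrite [X in _ && X]Pw andbT ltnNge; apply/negP => big.
have [i1] : exists i1, i1 \in [set u | f w < f u].
  by apply/card_gt0P; exact: leq_trans big.
rewrite inE => wi1.
pose x := [arg min_(i < i1 | f w < f i) f i]%O.
have [wx xmin] : f w < f x /\ forall v, f w < f v -> f x <= f v.
  by rewrite /x; case: arg_minP.
have : P x.
  apply: leq_trans big _; apply: subset_leq_card; apply/subsetP => u.
  by rewrite !inE; exact: xmin.
by move/wmax; rewrite leNgt wx.
Qed.

End LayerCake.

Section SparseLevelSets.
Variables (R : realType) (n : nat) (c : 'I_n -> 'I_n -> R).
Hypothesis cC : forall i j, c i j = c j i.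
Hypothesis c_ge0 : forall i j, 0 <= c i j.
Implicit Types (h : 'I_n -> R) (A : {set 'I_n}).

Lemma cut_energy A :
  \sum_u \sum_v c u v * `|(u \in A)%:R - (v \in A)%:R| = 2 * edge_weight c A (~: A).
Proof.
have -> : \sum_u \sum_v c u v * `|(u \in A)%:R - (v \in A)%:R| =
    \sum_u \sum_v (c u v * ((u \in A)%:R * (v \notin A)%:R) +
                   c u v * ((v \in A)%:R * (u \notin A)%:R)).
  apply: eq_bigr => u _; apply: eq_bigr => v _; rewrite -mulrDr; congr (_ * _).
  case: (u \in A); case: (v \in A) => /=;
  by rewrite ?subrr ?sub0r ?subr0 ?normrN ?normr0 ?normr1 ?mulr0 ?mul0r ?mulr1 ?addr0 ?add0r.
have e : \sum_u \sum_v c u v * ((u \in A)%:R * (v \notin A)%:R) = edge_weight c A (~: A).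
  rewrite /edge_weight [RHS]big_mkcond /=; apply: eq_bigr => u _.
  case: (u \in A); last by rewrite big1 // => v _; rewrite mul0r mulr0.
  rewrite [RHS]big_mkcond /=; apply: eq_bigr => v _; rewrite inE.
  by case: (v \in A); rewrite /= ?mulr0 ?mulr1.
under eq_bigr do rewrite big_split /=.
rewrite big_split /= [X in _ + X]exchange_big /= e.
have -> : \sum_j \sum_i c i j * ((j \in A)%:R * (i \notin A)%:R) = edge_weight c A (~: A).
  by rewrite -e; apply: eq_bigr => u _; apply: eq_bigr => v _; rewrite cC.
by rewrite mulr2n mulrDl mul1r.
Qed.

Variables (kappa k0 : R).
Hypothesis kappa_ge0 : 0 <= kappa.
Hypothesis expand : forall A, A != set0 -> #|A|%:R <= k0 ->
  kappa * #|A|%:R <= edge_weight c A (~: A).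

(** Cheeger's argument: every layer lies in the support of [h], so it is small enough to expand. The
    2 counts each edge in both directions. *)
Lemma coarea h : (forall u, 0 <= h u) -> #|[set u | 0 < h u]|%:R <= k0 ->
  2 * kappa * \sum_u h u <= \sum_u \sum_v c u v * `|h u - h v|.
Proof.
move=> h0 supp; have [s ls] := layer_cake h0; have [s0 sE sC] := ls.
have -> : \sum_u h u = \sum_(a <- s) a.1 * #|a.2|%:R.
  under eq_bigr do rewrite sE.
  rewrite exchange_big /=; apply: eq_bigr => a _; rewrite -mulr_sumr; congr (_ * _).
  by rewrite -sum1_card natr_sum [RHS]big_mkcond /=; apply: eq_bigr => u _; case: (u \in _).
have -> : \sum_u \sum_v c u v * `|h u - h v| =
    \sum_(a <- s) a.1 * \sum_u \sum_v c u v * `|(u \in a.2)%:R - (v \in a.2)%:R|.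
  under eq_bigr do under eq_bigr do rewrite -(layers_dist _ _ ls) mulr_sumr.
  under eq_bigr do rewrite exchange_big /=.
  rewrite exchange_big /=; apply: eq_bigr => a _; rewrite mulr_sumr.
  apply: eq_bigr => u _; rewrite mulr_sumr; apply: eq_bigr => v _.
  by rewrite mulrCA.
rewrite mulr_sumr big_seq [X in _ <= X]big_seq; apply: ler_sum => a as_.
rewrite cut_energy mulrCA; apply: ler_wpM2l; first exact: s0.
rewrite -mulrA ler_pM2l //.
have [->|nz] := eqVneq a.2 set0.
  by rewrite cards0 mulr0; apply: sumr_ge0 => u _; apply: sumr_ge0.
apply: expand => //; apply: le_trans supp; rewrite ler_nat.
apply: subset_leq_card; apply/subsetP => u ua; rewrite inE.
by have [] := sC a u u as_ ua.
Qed.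

Variables (r : nat) (B : 'I_n -> {set 'I_n}) (bad : {set 'I_n}).
Hypothesis n_gt0 : (0 < n)%N.
Hypothesis r_ge2 : (2 <= r)%N.
Hypothesis k0E : k0 = 5 * n%:R / (3 * r%:R).
Hypothesis bad_small : forall u, u \in bad -> #|B u|%:R <= 4 * n%:R / (3 * r%:R) :> R.

Let rpos : (0 : R) < r%:R. Proof. by rewrite ltr0n (leq_trans _ r_ge2). Qed.
Let npos : (0 : R) < n%:R. Proof. by rewrite ltr0n. Qed.

(* Lowering h by its (5n/3r)-th largest value t makes the support small; of the
   5n/3r vertices above t at most 4n/3r lie in B u, so n/3r of them witness
   min (h u) t outside B u. *)
Lemma bad_level_sets h : (forall u, 0 <= h u) ->
  2 * kappa * \sum_(u in bad)
    (h u - 3 * r%:R / n%:R * \sum_(v in ~: B u) Num.min (h u) (h v))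
  <= \sum_u \sum_v c u v * `|h u - h v|.
Proof.
(* With the successor, fewer than k vertices strictly above t means at most 5n/3r, and at least k
   vertices weakly above t means more than 5n/3r; ties are harmless. *)
move=> h0; pose k := (5 * n %/ (3 * r)).+1.
have r3 : (0 < 3 * r)%N by rewrite muln_gt0 /= (leq_trans _ r_ge2).
have kn : (0 < k <= #|'I_n|)%N.
  rewrite card_ord /k /= ltn_divLR // mulnA [(n * 3)%N]mulnC -mulnA.
  have := leq_mul (leqnn n) r_ge2; have := n_gt0; lia.
have [w /andP[k1 k2]] := order_statistic h kn.
pose t := h w; have t0 : 0 <= t by exact: h0.
pose h' u := Num.max (h u - t) 0.
have h'0 u : 0 <= h' u by rewrite le_max lexx orbT.
have supp : #|[set u | 0 < h' u]|%:R <= k0.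
  have -> : [set u | 0 < h' u] = [set u | t < h u].
    by apply/setP => u; rewrite !inE /h' lt_max ltxx orbF subr_gt0.
  rewrite k0E ler_pdivlMr ?mulr_gt0 // -!natrM ler_nat.
  by move: k1; rewrite /k ltnS leq_divRL // natrM.
apply: le_trans (le_trans (coarea h'0 supp) _); last first.
  apply: ler_sum => u _; apply: ler_sum => v _; apply: ler_wpM2l => //.
  rewrite /h' /Num.max.
  have lt1 (a b : R) : a <= b -> `|a - b| = b - a.
    by move=> ab; rewrite distrC ger0_norm // subr_ge0.
  case: ltP => a1; case: ltP => b1.
  - by rewrite subrr normr0.
  - rewrite sub0r normrN ger0_norm // lt1; lra.
  - rewrite subr0 ger0_norm // ger0_norm; lra.
  - by rewrite opprB addrA subrK.
rewrite -!mulrA ler_pM2l //; apply: ler_wpM2l => //.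
rewrite [X in _ <= X](bigID (mem bad)) /=.
rewrite -[X in X <= _]addr0; apply: lerD; last exact: sumr_ge0.
apply: ler_sum => u ubad.
set S := \sum_(v in ~: B u) _.
have S0 : 0 <= S by apply: sumr_ge0 => v _; rewrite le_min !h0.
suff : n%:R / (3 * r%:R) * Num.min (h u) t <= S.
  move=> le; have : Num.min (h u) t <= 3 * (r%:R * (n%:R^-1 * S)).
    move: le; rewrite -(@ler_pM2l _ (3 * r%:R / n%:R)); last by rewrite divr_gt0 ?mulr_gt0.
    have -> : 3 * r%:R / n%:R * (n%:R / (3 * r%:R) * Num.min (h u) t) = Num.min (h u) t.
      by field; rewrite !gt_eqF.
    by rewrite -!mulrA.
  rewrite /h' /Num.min /Num.max; case: ltP => a1; case: ltP => b1; lra.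
pose V := [set v | t <= h v] :\: B u.
have cV : n%:R / (3 * r%:R) <= #|V|%:R :> R.
  have h1 : (#|[set v | (t <= h v)%R]| <= #|V| + #|B u|)%N.
    rewrite /V -(cardsID (B u) [set v | (t <= h v)%R]) addnC leq_add2l.
    by apply: subset_leq_card; exact: subsetIr.
  have h2 := bad_small ubad.
  have h3 : 5 * n%:R / (3 * r%:R) <= #|[set v | t <= h v]|%:R :> R.
    rewrite ler_pdivrMr ?mulr_gt0 // -!natrM ler_nat [X in (_ <= X)%N]mulnC.
    apply: leq_trans (leq_mul (leqnn _) k2).
    by rewrite /k [X in (_ <= X)%N]mulnC ltnW // ltn_ceil.
  have h4 : #|[set v | t <= h v]|%:R <= #|V|%:R + #|B u|%:R :> R.
    by rewrite -natrD ler_nat.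
  have -> : n%:R / (3 * r%:R) = 5 * n%:R / (3 * r%:R) - 4 * n%:R / (3 * r%:R) :> R.
    by ring.
  lra.
apply: (@le_trans _ _ (#|V|%:R * Num.min (h u) t)).
  by apply: ler_wpM2r cV; rewrite le_min h0.
rewrite mulr_natl -sumr_const /S [X in X <= _]big_mkcond [X in _ <= X]big_mkcond /=.
apply: ler_sum => v _; rewrite !inE; case: (v \in B u) => //=.
case: ifP => tv; last by rewrite le_min !h0.
by rewrite le_min ge_min lexx /= ge_min tv orbT.
Qed.

Variables (p : 'I_n -> R) (d : 'I_n -> 'I_n -> R) (Z : finType) (g : Z -> 'I_n -> R).
Variable C : R.
Hypothesis p_ge0 : forall u, 0 <= p u.
Hypothesis g_ge0 : forall z u, 0 <= g z u.
Hypothesis g_sum : forall u, \sum_z g z u = 1.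
Hypothesis g_lip : forall u v,
  `|p u - p v| + Num.min (p u) (p v) * \sum_z `|g z u - g z v| <= C * d u v.
Hypothesis g_far : forall u v, v \notin B u ->
  \sum_z Num.min (g z u) (g z v) <= (6 * r%:R)^-1.

(** [bad_level_sets] is applied to each product of a layer of [p] with a [g z]. Because of the
    layers, overlaps carry the factor min (p u) (p v), at most p u however large p v is. The terms
    outside [B u] then cost at most (3r/n) n (p u) / (6r) = p u / 2, which leaves half of 2
    kappa. *)
Lemma bad_mass_le :
  kappa * \sum_(u in bad) p u <= C * \sum_u \sum_v c u v * d u v.
Proof.
have [s ls] := layer_cake p_ge0; have [s0 sE sC] := ls.
pose h (a : R * {set 'I_n}) z u := (u \in a.2)%:R * g z u.
have h0 a z u : 0 <= h a z u by rewrite mulr_ge0.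
have hmin a z u v : Num.min (h a z u) (h a z v) =
    (u \in a.2)%:R * (v \in a.2)%:R * Num.min (g z u) (g z v).
  rewrite /h; case: (u \in _); case: (v \in _); rewrite ?mul1r ?mul0r //.
  - by rewrite min_r.
  - by rewrite min_l.
  - by rewrite min_l.
have hdist a u v : \sum_z `|h a z u - h a z v| =
    `|(u \in a.2)%:R - (v \in a.2)%:R| +
    (u \in a.2)%:R * (v \in a.2)%:R * \sum_z `|g z u - g z v|.
  rewrite /h; case: (u \in _); case: (v \in _) => /=;
    rewrite ?mulr1 ?mulr0 ?mul0r ?addr0 ?subrr ?subr0 ?sub0r ?normrN ?normr1 ?normr0 ?add0r ?mul1r.
  - by apply: eq_bigr => z _; rewrite !mul1r.
  - by rewrite -[RHS](g_sum u); apply: eq_bigr => z _; rewrite mul1r mul0r subr0 ger0_norm.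
  - by rewrite -[RHS](g_sum v); apply: eq_bigr => z _; rewrite mul1r mul0r sub0r normrN ger0_norm.
  - by rewrite big1 // => z _; rewrite !mul0r subrr normr0.
have key : \sum_(a <- s) a.1 * \sum_z (2 * kappa * \sum_(u in bad)
      (h a z u - 3 * r%:R / n%:R * \sum_(v in ~: B u) Num.min (h a z u) (h a z v)))
    <= \sum_(a <- s) a.1 * \sum_z \sum_u \sum_v c u v * `|h a z u - h a z v|.
  rewrite big_seq [X in _ <= X]big_seq; apply: ler_sum => a as_.
  apply: ler_wpM2l; first exact: s0.
  by apply: ler_sum => z _; exact: bad_level_sets.
have rhs : \sum_(a <- s) a.1 * (\sum_z \sum_u \sum_v c u v * `|h a z u - h a z v|)
    <= C * \sum_u \sum_v c u v * d u v.
  have -> : \sum_(a <- s) a.1 * (\sum_z \sum_u \sum_v c u v * `|h a z u - h a z v|)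
    = \sum_u \sum_v c u v * \sum_(a <- s) a.1 * \sum_z `|h a z u - h a z v|.
    under [RHS]eq_bigr do under eq_bigr do rewrite mulr_sumr.
    under [RHS]eq_bigr do rewrite exchange_big /=.
    rewrite [RHS]exchange_big /=; apply: eq_bigr => a _.
    rewrite exchange_big /= mulr_sumr; apply: eq_bigr => u _.
    rewrite exchange_big /= mulr_sumr; apply: eq_bigr => v _.
    by rewrite -mulr_sumr mulrCA.
  rewrite mulr_sumr; apply: ler_sum => u _; rewrite mulr_sumr; apply: ler_sum => v _.
  rewrite mulrCA; apply: ler_wpM2l => //; apply: le_trans (g_lip u v).
  under eq_bigr do rewrite hdist mulrDr.
  rewrite big_split /= (layers_dist _ _ ls) lerD2l -(layers_min _ _ ls) mulr_suml.
  by apply: ler_sum => a _; rewrite [X in X <= _]mulrA.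
apply: le_trans rhs; apply: le_trans key.
have -> : \sum_(a <- s) a.1 * \sum_z (2 * kappa * \sum_(u in bad)
      (h a z u - 3 * r%:R / n%:R * \sum_(v in ~: B u) Num.min (h a z u) (h a z v))) =
    2 * kappa * \sum_(u in bad) (p u - 3 * r%:R / n%:R * \sum_(v in ~: B u)
      (Num.min (p u) (p v) * \sum_z Num.min (g z u) (g z v))).
  under eq_bigr do rewrite -mulr_sumr mulrCA.
  rewrite -mulr_sumr; congr (_ * _).
  under eq_bigr do rewrite exchange_big /= mulr_sumr.
  rewrite exchange_big /=; apply: eq_bigr => u _.
  under eq_bigr do rewrite sumrB mulrBr.
  rewrite sumrB; congr (_ - _).
    rewrite [RHS]sE; apply: eq_bigr => a _.
    by rewrite -mulr_sumr g_sum mulr1.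
  transitivity (\sum_(a <- s) 3 * r%:R / n%:R * (a.1 * \sum_z \sum_(v in ~: B u)
      Num.min (h a z u) (h a z v))).
    by apply: eq_bigr => a _; rewrite mulrCA [in RHS]mulr_sumr.
  rewrite -mulr_sumr; congr (_ * _).
  transitivity (\sum_(a <- s) \sum_(v in ~: B u)
      a.1 * \sum_z Num.min (h a z u) (h a z v)).
    by apply: eq_bigr => a _; rewrite -mulr_sumr [in RHS]exchange_big.
  rewrite exchange_big /=; apply: eq_bigr => v _.
  rewrite -(layers_min _ _ ls) mulr_suml; apply: eq_bigr => a _.
  by under eq_bigr do rewrite hmin; rewrite -mulr_sumr mulrA.
set X := \sum_(u in bad) (p u - _).
have -> : 2 * kappa * X = kappa * (2 * X) by ring.
apply: ler_wpM2l => //; rewrite mulr_sumr.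
apply: ler_sum => u _.
have : \sum_(v in ~: B u) (Num.min (p u) (p v) * \sum_z Num.min (g z u) (g z v))
    <= n%:R * (p u * (6 * r%:R)^-1).
  have pos : 0 <= p u * (6 * r%:R)^-1 by rewrite mulr_ge0 // invr_ge0 mulr_ge0 // ltW.
  rewrite -[X in X%:R]card_ord mulr_natl -sumr_const big_mkcond /=.
  apply: ler_sum => v _; rewrite inE; case: ifP => // nv.
  apply: ler_pM; rewrite ?le_min ?p_ge0 //.
  - by apply: sumr_ge0 => z _; rewrite le_min !g_ge0.
  - by rewrite ge_min lexx.
  - exact: g_far.
move=> le.
have : 3 * r%:R / n%:R * \sum_(v in ~: B u) (Num.min (p u) (p v) *
    \sum_z Num.min (g z u) (g z v)) <= 3 * r%:R / n%:R * (n%:R * (p u * (6 * r%:R)^-1)).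
  by apply: ler_wpM2l le; rewrite divr_ge0 ?mulr_ge0 // ltW.
have -> : 3 * r%:R / n%:R * (n%:R * (p u * (6 * r%:R)^-1)) = p u / 2.
  by field; rewrite !gt_eqF.
lra.
Qed.

End SparseLevelSets.

(** * Normalized vectors *)

Section Normalization.
Variable R : realType.

(** If b is the largest norm, both left denominators are b. Otherwise k2 / max b c, a fraction at
    most 1, only grows when a - max b c is added to numerator and denominator, and all denominators
    become a. *)
Lemma normalized_tri_aux (a b c k1 k2 k3 : R) : 0 < a -> 0 < b -> c <= a ->
  0 <= k3 -> k2 <= b -> k1 + k2 <= b + k3 ->
  k1 / Num.max a b + k2 / Num.max b c <= 1 + k3 / a.
Proof.
move=> a0 b0 ca k30 k2b h.
have [ab|/ltW ba] := leP a b.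
  rewrite max_l; last exact: le_trans ab.
  rewrite -mulrDl; apply: (@le_trans _ _ (1 + k3 / b)).
    by rewrite -[1](divff (lt0r_neq0 b0)) -mulrDl ler_pM2r ?invr_gt0.
  by rewrite lerD2l ler_wpM2l // lef_pV2.
set M := Num.max b c.
have bM : b <= M by rewrite le_max lexx.
have M0 : 0 < M by exact: lt_le_trans bM.
have Ma : M <= a by rewrite ge_max ba ca.
have k2M : k2 / M <= (k2 + (a - M)) / a.
  rewrite ler_pdivrMr // mulrAC ler_pdivlMr //; nra.
apply: (@le_trans _ _ ((k1 + (k2 + (a - M))) / a)); first by rewrite mulrDl lerD2l.
rewrite -[1](divff (lt0r_neq0 a0)) -mulrDl ler_pM2r ?invr_gt0 //; lra.
Qed.

Lemma normalized_tri (a b c k1 k2 k3 : R) : 0 < a -> 0 < b -> 0 < c ->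
  0 <= k3 -> k1 <= b -> k2 <= b -> k1 + k2 <= b + k3 ->
  k1 / Num.max a b + k2 / Num.max b c <= 1 + k3 / Num.max a c.
Proof.
move=> a0 b0 c0 k30 k1b k2b h; have [ca|/ltW ac] := leP c a.
  exact: normalized_tri_aux.
rewrite addrC [Num.max a b]maxC [Num.max b c]maxC.
by apply: normalized_tri_aux => //; rewrite addrC.
Qed.

Variables (I : finType) (dim : nat) (x : I -> 'rV[R]_dim).

(** An explicit Schur product: each layer contributes one more block of coordinates, holding the
    [x u] scaled by sqrt a.1 and set to zero off the layer. *)
Lemma gram_layers (s : seq (R * {set I})) : (forall a, a \in s -> 0 <= a.1) ->
  exists (N : nat) (y : I -> nat -> R), forall u v,
    \sum_(i < N) y u i * y v i =
    (\sum_(a <- s) a.1 * ((u \in a.2)%:R * (v \in a.2)%:R)) * inner (x u) (x v).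
Proof.
elim: s => [|a s IH] s0.
  by exists 0%N, (fun _ _ => 0) => u v; rewrite big_ord0 big_nil mul0r.
have [|N [y yE]] := IH; first by move=> b bs; apply: s0; rewrite inE bs orbT.
have a0 : 0 <= a.1 by apply: s0; rewrite inE eqxx.
pose coord u (i : nat) : R := if insub i is Some j then x u 0 j else 0.
exists (dim + N)%N, (fun u i => if (i < dim)%N
  then Num.sqrt a.1 * (u \in a.2)%:R * coord u i else y u (i - dim)%N) => u v.
rewrite big_split_ord big_cons mulrDl -yE /=; congr (_ + _); last first.
  by apply: eq_bigr => i _; rewrite ltnNge leq_addr /= addKn.
rewrite /inner mulr_sumr; apply: eq_bigr => i _.
rewrite ltn_ord /coord valK -[in RHS](sqr_sqrtr a0); ring.
Qed.

Let k u v := inner (x u) (x v).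
Let p u := k u u.
Hypothesis k_ge0 : forall u v, 0 <= k u v.
Hypothesis k_le : forall u v, k u v <= p u.
Hypothesis k_tri : forall u v w, k u v + k v w <= p v + k u w.

Let kC u v : k u v = k v u.
Proof. by apply: eq_bigr => i _; rewrite mulrC. Qed.

(** Written with a minimum of inverses because the layers of 1 / p realize that as a Gram matrix. As
    the inverse of 0 is 0, a vertex of norm 0 gets the zero vector. *)
Let normalized u v := Num.min (p u)^-1 (p v)^-1 * k u v.

Let normalizedE u v : 0 < p u -> 0 < p v -> normalized u v = k u v / Num.max (p u) (p v).
Proof.
move=> u0 v0; rewrite /normalized mulrC; congr (_ * _).
have [le|/ltW le] := leP (p u) (p v).
  by rewrite min_r // lef_pV2.
by rewrite min_l // lef_pV2.
Qed.

Let normalized0 u v : p u = 0 -> normalized u v = 0.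
Proof.
move=> pu; rewrite /normalized (_ : k u v = 0) ?mulr0 //.
by apply/le_anti; rewrite k_ge0 -pu k_le.
Qed.

Let normalizedC u v : normalized u v = normalized v u.
Proof. by rewrite /normalized minC kC. Qed.

Let p_cases u : p u = 0 \/ 0 < p u.
Proof.
by have := k_ge0 u u; rewrite -/(p u) le_eqVlt => /orP[/eqP <-|]; [left | right].
Qed.

Let normalized_ge0 u v : 0 <= normalized u v.
Proof. by rewrite mulr_ge0 // le_min !invr_ge0 !k_ge0. Qed.

Let normalizedxx u : 0 < p u -> normalized u u = 1.
Proof. by move=> u0; rewrite normalizedE // maxxx divff // gt_eqF. Qed.

Let normalized_le1 u v : normalized u v <= 1.
Proof.
have [/normalized0 -> //|u0] := p_cases u.
have [/normalized0 h|v0] := p_cases v; first by rewrite normalizedC h.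
by rewrite normalizedE // ler_pdivrMr ?lt_max ?u0 // mul1r le_max k_le.
Qed.

Lemma normalized_vectors : exists (N : nat) (y : I -> nat -> R),
  [/\ forall u v w, dist2 N y u w <= dist2 N y u v + dist2 N y v w,
      forall u, norm2 N (y u) <= 1,
      forall u v, Num.min (p u) (p v) * dist2 N y u v <= 2 * (p u + p v - 2 * k u v)
    & forall u v, 0 < p u -> dist2 N y u v < 1 ->
        p u + p v - 2 * k u v <= 2 * dist2 N y u v * p u].
Proof.
have [s ls] : exists s, layers (fun u => (p u)^-1) s.
  by apply: layer_cake => u; rewrite invr_ge0; exact: k_ge0.
have [s0 _ _] := ls.
have [N [y yE]] := gram_layers s0.
have gram u v : \sum_(i < N) y u i * y v i = normalized u v.
  by rewrite yE (layers_min _ _ ls).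
have normE u : norm2 N (y u) = normalized u u.
  by rewrite -gram; apply: eq_bigr => i _; rewrite expr2.
have dE u v : dist2 N y u v = normalized u u + normalized v v - 2 * normalized u v.
  rewrite -!gram mulr_sumr -big_split -sumrB /=; apply: eq_bigr => i _; ring.
exists N, y; split=> [u v w|u|u v|u v u0].
- suff : normalized u v + normalized v w <= normalized v v + normalized u w.
    rewrite !dE; lra.
  have [v0|v0] := p_cases v.
    by rewrite normalizedC !(normalized0 _ v0) add0r add0r.
  rewrite (normalizedxx v0).
  have [u0|u0] := p_cases u.
    by rewrite !(normalized0 _ u0) add0r addr0.
  have [w0|w0] := p_cases w.
    by rewrite ![normalized _ w]normalizedC !(normalized0 _ w0) !addr0.
  rewrite !normalizedE //; apply: normalized_tri; rewrite ?k_ge0 ?k_le //.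
  by rewrite kC k_le.
- by rewrite normE.
- have d0 : 0 <= p u + p v - 2 * k u v by have := k_le u v; have := k_le v u; rewrite kC; lra.
  have [u0|u0] := p_cases u.
    have -> : Num.min (p u) (p v) = 0 by rewrite u0 min_l //; exact: k_ge0.
    by rewrite mul0r mulr_ge0.
  have [v0|v0] := p_cases v.
    have -> : Num.min (p u) (p v) = 0 by rewrite v0 min_r //; exact: k_ge0.
    by rewrite mul0r mulr_ge0.
  rewrite dE (normalizedxx u0) (normalizedxx v0) normalizedE //.
  have := k_le u v; have := k_le v u; rewrite [k v u]kC => kv ku.
  have [le|/ltW le] := leP (p u) (p v).
    have : p u * (1 - k u v / p v) <= p v * (1 - k u v / p v).
      by apply: ler_wpM2r => //; rewrite subr_ge0 ler_pdivrMr ?mul1r.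
    have -> : p v * (1 - k u v / p v) = p v - k u v by field; rewrite gt_eqF.
    nra.
  have : p v * (1 - k u v / p u) <= p u * (1 - k u v / p u).
    by apply: ler_wpM2r => //; rewrite subr_ge0 ler_pdivrMr ?mul1r.
  have -> : p u * (1 - k u v / p u) = p u - k u v by field; rewrite gt_eqF.
  nra.
(* A zero vector is at distance exactly 1 from the unit vector of u, which the bound dist < 1
   excludes. Below, that bound makes the normalized product t exceed 1/2, so p v enters with the
   negative coefficient 1 - 2 t when p u <= p v. *)
have [v0|v0] := p_cases v.
  rewrite dE normalizedxx // (normalized0 _ v0) normalizedC (normalized0 _ v0).
  by rewrite mulr0 subr0 addr0 ltxx.
rewrite dE (normalizedxx u0) (normalizedxx v0) normalizedE //.
have := k_le u v; have := k_le v u; rewrite [k v u]kC => kv ku.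
have [le|/ltW le] := leP (p u) (p v).
  set t := k u v / p v => h.
  have tE : t * p v = k u v by rewrite /t divfK // gt_eqF.
  have : t * p v <= p u by rewrite tE.
  nra.
set t := k u v / p u => h.
have tE : t * p u = k u v by rewrite /t divfK // gt_eqF.
nra.
Qed.

End Normalization.

(** * Geometry of Lasserre vectors *)

Section Geometry.
Variables (R : realType) (d : nat).
Implicit Types u v w : 'rV[R]_d.

Lemma innerC u v : inner u v = inner v u.
Proof. by apply: eq_bigr => i _; rewrite mulrC. Qed.

Lemma innerDl u v w : inner (u + v) w = inner u w + inner v w.
Proof. by rewrite /inner -big_split; apply: eq_bigr => i _; rewrite mxE mulrDl. Qed.

Lemma innerZl (a : R) u v : inner (a *: u) v = a * inner u v.
Proof. by rewrite /inner mulr_sumr; apply: eq_bigr => i _; rewrite mxE mulrA. Qed.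

Lemma innerBl u v w : inner (u - v) w = inner u w - inner v w.
Proof. by rewrite -scaleN1r innerDl innerZl mulN1r. Qed.

Lemma innerDr u v w : inner w (u + v) = inner w u + inner w v.
Proof. by rewrite innerC innerDl !(innerC w). Qed.

Lemma innerBr u v w : inner w (u - v) = inner w u - inner w v.
Proof. by rewrite innerC innerBl !(innerC w). Qed.

Lemma innerZr (a : R) u v : inner v (a *: u) = a * inner v u.
Proof. by rewrite innerC innerZl innerC. Qed.

Lemma inner_suml (I : finType) (f : I -> 'rV[R]_d) v :
  inner (\sum_i f i) v = \sum_i inner (f i) v.
Proof.
rewrite /inner exchange_big /=; apply: eq_bigr => i _.
by rewrite summxE mulr_suml.
Qed.

Lemma sqnorm_ge0 u : 0 <= sqnorm u.
Proof. by apply: sumr_ge0 => i _; rewrite -expr2 sqr_ge0. Qed.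

Lemma sqnormB u v : sqnorm (u - v) = sqnorm u + sqnorm v - 2 * inner u v.
Proof. rewrite /sqnorm innerBl !innerBr (innerC v u); ring. Qed.

Lemma sqnorm_eq0 u : sqnorm u = 0 -> u = 0.
Proof.
move=> u0; apply/rowP => i; rewrite mxE; apply/eqP.
have /eqP := u0; rewrite /sqnorm /inner psumr_eq0; last first.
  by move=> j _; rewrite -expr2 sqr_ge0.
by move/allP/(_ i (mem_index_enum i)); rewrite /= mulf_eq0 orbb.
Qed.

Lemma innerE u v : inner u v = (u *m v^T) 0 0.
Proof. by rewrite mxE; apply: eq_bigr => i _; rewrite mxE. Qed.

Section Projection.
Variable W : 'M[R]_d.
Let K := kermx W^T.

Lemma kermx_orthogonal u v : (u <= K)%MS -> (v <= W)%MS -> inner u v = 0.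
Proof.
move=> /sub_kermxP uK /submxP[a ->].
by rewrite innerE trmx_mul mulmxA uK mul0mx mxE.
Qed.

Lemma kermx_cap0 : (K :&: W)%MS = 0.
Proof.
apply/eqP; rewrite -submx0; apply/rV_subP => v; rewrite sub_capmx => /andP[vK vW].
by rewrite (sqnorm_eq0 (kermx_orthogonal vK vW)) sub0mx.
Qed.

Lemma kermx_full u : (u <= K + W)%MS.
Proof.
apply: submx_full; rewrite /row_full.
have := mxrank_disjoint_sum kermx_cap0.
by rewrite mxrank_ker mxrank_tr subnK ?rank_leq_row // => ->.
Qed.

(** Pythagoras: u - w has the same component orthogonal to [W] as u. *)
Lemma proj_perp_le u w : (w <= W)%MS -> sqnorm (proj_perp W u) <= sqnorm (u - w).
Proof.
move=> wW; pose a := proj_perp W u; pose b := (u - w) *m proj_mx W K.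
have aE : a = (u - w) *m proj_mx K W.
  by rewrite mulmxBl (proj_mx_0 kermx_cap0 wW) subr0.
have -> : u - w = a + b by rewrite aE add_proj_mx ?kermx_cap0 ?kermx_full.
have ab : inner a b = 0.
  by apply: kermx_orthogonal; rewrite ?aE proj_mx_sub.
rewrite -/a /sqnorm innerDl !innerDr (innerC b a) ab addr0 add0r.
by rewrite lerDl sqnorm_ge0.
Qed.

End Projection.
End Geometry.

Section LasserreVectors.
Variables (R : realType) (n d t : nat) (x : plabel n -> 'rV[R]_d).
Hypothesis t_ge2 : (2 <= t)%N.
Hypothesis lasx : Las t x.
Implicit Types (f g : plabel n) (u v w : 'I_n).

Local Notation e := (x (pempty n)).
Local Notation s u b := (psingle u b).

Lemma pdom_merge f g : pdom (pmerge f g) = pdom f :|: pdom g.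
Proof. by apply/setP => u; rewrite !inE ffunE; case: (f u). Qed.

Lemma pdom_single u b : pdom (s u b) = [set u].
Proof. by apply/setP => v; rewrite !inE ffunE; case: (v == u). Qed.

Lemma pdom_empty : pdom (pempty n) = set0.
Proof. by apply/setP => v; rewrite !inE ffunE. Qed.

Lemma pmergef0 f : pmerge f (pempty n) = f.
Proof. by apply/ffunP => u; rewrite !ffunE; case: (f u). Qed.

Lemma pmergeff f : pmerge f f = f.
Proof. by apply/ffunP => u; rewrite !ffunE; case: (f u). Qed.

Lemma pdisagreeff f : ~ pdisagree f f.
Proof. by case=> u [_ _]; rewrite eqxx. Qed.

Lemma pdisagree_disjoint f u b : u \notin pdom f -> ~ pdisagree f (s u b).
Proof. by move=> uf [v [vf]]; rewrite pdom_single inE => /eqP vu; rewrite vu (negbTE uf) in vf. Qed.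

Lemma inner_empty f : (#|pdom f| <= t.+1)%N -> inner (x f) e = sqnorm (x f).
Proof.
move=> df; have [_ _ consistent _] := lasx; apply: consistent => //.
- by rewrite pdom_empty cards0.
- by case=> u [_]; rewrite pdom_empty inE.
- exact: pdisagreeff.
- by rewrite pmergef0 pmergeff.
Qed.

Lemma inner_merge f g : (#|pdom f| + #|pdom g| <= t.+1)%N -> ~ pdisagree f g ->
  inner (x f) (x g) = sqnorm (x (pmerge f g)).
Proof.
move=> dfg ndis; have [_ _ consistent _] := lasx.
have dm : (#|pdom (pmerge f g)| <= t.+1)%N.
  by rewrite pdom_merge (leq_trans (leq_card_setU _ _)).
apply: consistent => //; rewrite ?pmergeff //; last exact: pdisagreeff.
  exact: leq_trans (leq_addr _ _) dfg.
exact: leq_trans (leq_addl _ _) dfg.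
Qed.

Lemma card_single u b : #|pdom (s u b)| = 1%N.
Proof. by rewrite pdom_single cards1. Qed.

(** The squared norm of the difference vanishes: the two parts are orthogonal, their squared norms
    add up to that of [e], and the inner product of each with [e] is its squared norm. *)
Lemma empty_split u : e = x (s u false) + x (s u true).
Proof.
apply/eqP; rewrite -subr_eq0; apply/eqP; apply: sqnorm_eq0.
have [e1 orth _ tot] := lasx.
have d1 b : (#|pdom (s u b)| <= t.+1)%N by rewrite card_single.
have o : inner (x (s u false)) (x (s u true)) = 0.
  apply: orth => //; exists u; rewrite !pdom_single !inE eqxx; split=> //.
  by rewrite !ffunE eqxx.
rewrite sqnormB innerC innerDl !inner_empty //.
have -> : sqnorm (x (s u false) + x (s u true)) =
    sqnorm (x (s u false)) + sqnorm (x (s u true)).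
  by rewrite /sqnorm innerDl !innerDr (innerC (x (s u true)) (x (s u false))) o addr0 add0r.
have := tot u; lra.
Qed.

(** Squared norms behave as probabilities of partial labelings, and this is the law of total
    probability. *)
Lemma sqnorm_split f u : u \notin pdom f -> (#|pdom f| <= t)%N ->
  sqnorm (x f) = sqnorm (x (pmerge f (s u false))) + sqnorm (x (pmerge f (s u true))).
Proof.
move=> uf df; rewrite -inner_empty; last exact: leq_trans df _.
rewrite (empty_split u) innerDr !inner_merge //; try exact: pdisagree_disjoint.
  by rewrite card_single addn1.
by rewrite card_single addn1.
Qed.

Lemma inner_single_ge0 u v a b : 0 <= inner (x (s u a)) (x (s v b)).
Proof.
have [uv|uv] := eqVneq v u.
  have [_ orth _ _] := lasx; subst v.
  have [->|ab] := eqVneq a b; first exact: sqnorm_ge0.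
  rewrite orth ?card_single //; exists u; rewrite !pdom_single !inE eqxx; split=> //.
  by rewrite !ffunE eqxx; apply: contra_neq ab => -[].
rewrite inner_merge ?sqnorm_ge0 // ?card_single ?(leqW t_ge2) //.
by apply: pdisagree_disjoint; rewrite pdom_single inE.
Qed.

Lemma inner_vtx_ge0 u v : 0 <= inner (vtx x u) (vtx x v).
Proof. exact: inner_single_ge0. Qed.

Lemma inner_vtx_empty u : inner (vtx x u) e = inner (vtx x u) (vtx x u).
Proof. by rewrite inner_empty // card_single. Qed.

Lemma inner_vtx_le u v : inner (vtx x u) (vtx x v) <= inner (vtx x u) (vtx x u).
Proof.
rewrite -[X in _ <= X]inner_vtx_empty (empty_split v) innerDr lerDr.
exact: inner_single_ge0.
Qed.

(** Equivalent to the triangle inequality for squared distances. For distinct vertices, expanding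
    over the labelings of {u, v, w} leaves the right side larger by the weights of 010 and 101. *)
Lemma inner_vtx_tri u v w :
  inner (vtx x u) (vtx x v) + inner (vtx x v) (vtx x w) <=
  inner (vtx x v) (vtx x v) + inner (vtx x u) (vtx x w).
Proof.
have [->|uv] := eqVneq u v; first by rewrite lexx.
have [->|vw] := eqVneq v w; first by rewrite addrC lexx.
have [->|uw] := eqVneq u w.
  have := sqnorm_ge0 (vtx x v - vtx x w); rewrite sqnormB /sqnorm (innerC (vtx x w) (vtx x v)); lra.
have vu : (v == u) = false by rewrite eq_sym; exact: negbTE.
have wu : (w == u) = false by rewrite eq_sym; exact: negbTE.
have wv : (w == v) = false by rewrite eq_sym; exact: negbTE.
pose F a b c := pmerge (pmerge (s u a) (s v b)) (s w c).
have E f u' : (#|pdom f| <= 2)%N -> u' \notin pdom f ->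
    sqnorm (x f) = sqnorm (x (pmerge f (s u' false))) + sqnorm (x (pmerge f (s u' true))).
  by move=> df uf; apply: sqnorm_split => //; exact: leq_trans t_ge2.
have d2 u' v' a b : (#|pdom (pmerge (s u' a) (s v' b))| <= 2)%N.
  by rewrite pdom_merge (leq_trans (leq_card_setU _ _)) // !card_single.
have pairE u' v' : u' != v' -> inner (vtx x u') (vtx x v') = sqnorm (x (pmerge (s u' true) (s v' true))).
  move=> uv'; apply: inner_merge; first by rewrite !card_single (leqW t_ge2).
  by apply: pdisagree_disjoint; rewrite pdom_single inE eq_sym.
have vE : inner (vtx x v) (vtx x v) = sqnorm (x (F false true false)) +
    sqnorm (x (F false true true)) + (sqnorm (x (F true true false)) + sqnorm (x (F true true true))).
  rewrite -[inner _ _]/(sqnorm (x (s v true))) (E _ u) ?card_single //; last first.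
    by rewrite pdom_single inE.
  rewrite !(E (pmerge (s v true) _) w) ?d2 //; try by
    rewrite pdom_merge !pdom_single !inE wv wu.
  have C a c : pmerge (pmerge (s v true) (s u a)) (s w c) = F a true c.
    apply/ffunP => i; rewrite !ffunE.
    by case: (i =P v) => [->|_]; rewrite ?vu //; case: (i == u).
  by rewrite !C.
have uvE : inner (vtx x u) (vtx x v) = sqnorm (x (F true true false)) + sqnorm (x (F true true true)).
  rewrite pairE // (E _ w) ?d2 // pdom_merge !pdom_single !inE.
  by rewrite wu wv.
have vwE : inner (vtx x v) (vtx x w) = sqnorm (x (F false true true)) + sqnorm (x (F true true true)).
  rewrite pairE // (E _ u) ?d2 //; last by rewrite pdom_merge !pdom_single !inE negb_or uv uw.
  have C a : pmerge (pmerge (s v true) (s w true)) (s u a) = F a true true.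
    apply/ffunP => i; rewrite !ffunE.
    case: (i =P v) => [->|_]; first by rewrite vu.
    by case: (i =P w) => [->|_]; [rewrite wu | case: (i == u)].
  by rewrite !C.
have uwE : inner (vtx x u) (vtx x w) = sqnorm (x (F true false true)) + sqnorm (x (F true true true)).
  rewrite pairE // (E _ v) ?d2 //; last first.
    by rewrite pdom_merge !pdom_single !inE negb_or vu vw.
  have C b : pmerge (pmerge (s u true) (s w true)) (s v b) = F true b true.
    apply/ffunP => i; rewrite !ffunE.
    case: (i =P u) => // _.
    by case: (i =P w) => [->|_]; [rewrite wv | case: (i == v)].
  by rewrite !C.
rewrite uvE vwE uwE vE.
have := sqnorm_ge0 (x (F false true false)); have := sqnorm_ge0 (x (F true false true)); lra.
Qed.

End LasserreVectors.

(** * Proof of the theorem *)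

Section Packing.
Variables (I : finType) (B : I -> {set I}) (G : {set I}).
Hypothesis B_refl : forall u, u \in B u.

Lemma maximal_packing : exists S : {set I},
  [/\ S \subset G,
      (\sum_(s in S) #|B s| <= #|I|)%N
    & forall u, u \in G -> exists2 s, s \in S & exists v, (v \in B u) && (v \in B s)].
Proof.
pose P (S : {set I}) := (S \subset G) &&
  [forall s in S, forall s' in S, (s != s') ==> [disjoint B s & B s']].
have P0 : P set0 by rewrite /P sub0set; apply/forall_inP => s; rewrite inE.
pose S := [arg max_(S > set0 | P S) #|S|]%N.
have [/andP[SG /forall_inP dis] Smax] : P S /\ forall T, P T -> (#|T| <= #|S|)%N.
  by rewrite /S; case: arg_maxnP.
have disj s s' v : s \in S -> s' \in S -> v \in B s -> v \in B s' -> s = s'.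
  move=> sS s'S vs vs'; apply/eqP; apply/negPn/negP => ne.
  have /forall_inP/(_ s' s'S)/implyP/(_ ne) := dis s sS.
  by rewrite disjoint_subset => /subsetP/(_ v vs); rewrite inE vs'.
exists S; split=> // [|u uG].
  rewrite (eq_bigr (fun s => \sum_(v : I) (v \in B s : nat))); last first.
    by move=> s _; rewrite -sum1_card big_mkcond /=; apply: eq_bigr => v _; case: (v \in _).
  rewrite exchange_big /= -sum1_card; apply: leq_sum => v _.
  have [s /andP[sS vs]|none] := pickP (fun s => (s \in S) && (v \in B s)).
    rewrite (bigD1 s) //= vs big1 // => s' /andP[s'S ne].
    case vs' : (v \in B s') => //.
    by rewrite (disj _ _ _ sS s'S vs vs') eqxx in ne.
  by rewrite big1 // => s sS; have := none s; rewrite sS /= => ->.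
have [s /andP[sS /existsP[v hv]]|none] := pickP (fun s => (s \in S) && [exists v, (v \in B u) && (v \in B s)]).
  by exists s => //; exists v.
exfalso; have far s : s \in S -> [disjoint B u & B s].
  move=> sS; rewrite disjoint_subset; apply/subsetP => v vu; rewrite inE.
  apply/negP => vs; have := none s; rewrite sS /=.
  by move/negbT/existsPn/(_ v); rewrite vu vs.
have uS : u \notin S.
  apply/negP => /far; rewrite disjoint_subset => /subsetP/(_ u (B_refl u)).
  by rewrite inE B_refl.
have : P (u |: S).
  rewrite /P subUset sub1set uG SG /=; apply/forall_inP => s.
  rewrite !inE => /orP[/eqP ->|sS]; apply/forall_inP => s'; rewrite !inE => /orP[/eqP ->|s'S];
    apply/implyP => ne; rewrite ?eqxx // in ne *.
  - exact: far.
  - by rewrite disjoint_sym; exact: far.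
  - by have /forall_inP/(_ s' s'S)/implyP/(_ ne) := dis s sS.
by move/Smax; rewrite cardsU1 uS add1n ltnn.
Qed.

Lemma superset_of_card (S : {set I}) (r : nat) : (#|S| <= r <= #|I|)%N ->
  exists T : {set I}, #|T| = r /\ S \subset T.
Proof.
case/andP=> Sr rI; have [k] := ubnP (r - #|S|); elim: k S Sr => // k IH S Sr Sk.
have [/eqP e|ne] := boolP (#|S| == r); first by exists S.
have lt : (#|S| < r)%N by rewrite ltn_neqAle ne.
have [u uS] : exists u, u \notin S.
  have : ~~ (setT \subset S).
    by apply/negP => /subset_leq_card; rewrite cardsT leqNgt (leq_trans lt).
  by case/subsetPn => u _ uS; exists u.
have cU : #|u |: S| = #|S|.+1 by rewrite cardsU1 uS.
have [||T [cT sT]] := IH (u |: S); rewrite ?cU //; first by move: Sk lt; lia.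
by exists T; split=> //; apply: subset_trans sT; exact: subsetUr.
Qed.

End Packing.

Lemma sum_symmetric (R : realType) (n : nat) (f : 'I_n -> 'I_n -> R) :
  (forall u v, f u v = f v u) -> (forall u, f u u = 0) ->
  \sum_u \sum_v f u v = 2 * \sum_(u < n) \sum_(v < n | (u < v)%N) f u v.
Proof.
move=> fC f0.
have -> : \sum_u \sum_v f u v = \sum_(u < n) \sum_(v < n | (u < v)%N) f u v +
    \sum_(u < n) \sum_(v < n | (v < u)%N) f u v.
  rewrite -big_split; apply: eq_bigr => u _ /=.
  rewrite (bigID (fun v : 'I_n => (u < v)%N)) /=; congr (_ + _).
  rewrite (bigD1 u) ?ltnn //= f0 add0r; apply: eq_bigl => v.
  by rewrite -leqNgt ltn_neqAle andbC; congr (_ && _); rewrite -val_eqE.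
rewrite [X in _ + X](exchange_big_dep xpredT) //= mulr2n mulrDl mul1r; congr (_ + _).
by apply: eq_bigr => u _; apply: eq_bigr => v _.
Qed.

Section Feasible.
Variables (R : realType) (n d t : nat) (mu : R) (x : plabel n -> 'rV[R]_d).
Hypothesis t_ge2 : (2 <= t)%N.
Hypothesis n_gt0 : (0 < n)%N.
Hypothesis feas : feasible t mu x.

Local Notation V := (vtx x).

Let lasx : Las t x. Proof. by case: feas. Qed.
Let n_neq0 : n%:R != 0 :> R. Proof. by rewrite pnatr_eq0 -lt0n. Qed.

Lemma shiftedE u : shifted x u = V u - mu *: x (pempty n).
Proof. by have [_ _ mean] := feas; rewrite /shifted mean. Qed.

Lemma mu_bounds : 0 < mu <= 1 / 2.
Proof.
have [[k [k0 kn ->]] _ _] := feas; have np : (0 : R) < n%:R by rewrite ltr0n.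
rewrite divr_gt0 ?ltr0n //= ler_pdivrMr //.
have : (2 * k)%:R <= n%:R :> R by rewrite ler_nat.
by rewrite natrM; lra.
Qed.

Lemma sum_sqnorm_vtx : \sum_u sqnorm (V u) = n%:R * mu.
Proof.
have [_ _ mean] := feas; have [e1 _ _ _] := lasx.
have -> : \sum_u sqnorm (V u) = inner (\sum_u V u) (x (pempty n)).
  rewrite inner_suml; apply: eq_bigr => u _.
  by rewrite (inner_vtx_empty lasx).
have -> : \sum_u V u = (n%:R * mu) *: x (pempty n).
  by rewrite -scalerA -mean scalerA divff // scale1r.
by rewrite innerZl -/(sqnorm _) e1 mulr1.
Qed.

Lemma sqnorm_shifted u :
  sqnorm (shifted x u) = sqnorm (V u) - 2 * mu * sqnorm (V u) + mu ^+ 2.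
Proof.
have [e1 _ _ _] := lasx.
rewrite shiftedE sqnormB innerZr (inner_vtx_empty lasx) -/(sqnorm _).
rewrite {2}/sqnorm innerZl innerZr -/(sqnorm _) e1; ring.
Qed.

Lemma frob_shifted : frob_sq (shifted x) = n%:R * mu * (1 - mu).
Proof.
rewrite /frob_sq; under eq_bigr do rewrite sqnorm_shifted.
rewrite !big_split /= sumrN -mulr_sumr sum_sqnorm_vtx sumr_const card_ord -mulr_natl; ring.
Qed.

Lemma residual_le_shifted (S : {set 'I_n}) u :
  sqnorm (proj_perp (span_of (shifted x) S) (shifted x u)) <= sqnorm (shifted x u).
Proof. by rewrite -[X in _ <= sqnorm X]subr0; apply: proj_perp_le; exact: sub0mx. Qed.

Lemma residual_le_dist (S : {set 'I_n}) u s : s \in S ->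
  sqnorm (proj_perp (span_of (shifted x) S) (shifted x u)) <= sqnorm (V u - V s).
Proof.
move=> sS; have -> : V u - V s = shifted x u - shifted x s.
  by rewrite !shiftedE opprB addrA subrK.
apply: proj_perp_le; rewrite /span_of (sumsmx_sup s) //.
by rewrite genmxE.
Qed.

Lemma sum_capacity_dist (c : 'I_n -> 'I_n -> R) : regular_capacity c ->
  \sum_u \sum_v c u v * sqnorm (V u - V v) = 2 * objective c mu x * (n%:R * mu * (1 - mu)).
Proof.
case=> cC _ _; rewrite sum_symmetric; last first.
- by move=> u; rewrite subrr /sqnorm /inner big1 ?mulr0 // => i _; rewrite mxE mul0r.
- by move=> u v; rewrite cC; congr (_ * _); rewrite !sqnormB (innerC (V v) (V u)) [sqnorm (V v) + _]addrC.
have /andP[m0 m1] := mu_bounds.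
rewrite /objective; set T := \sum_(_ < _) _.
have : n%:R * mu * (1 - mu) != 0.
  by rewrite !mulf_neq0 ?(gt_eqF m0) // gt_eqF //; lra.
by move: (n%:R * mu * (1 - mu)) => a a0; field.
Qed.

End Feasible.

(** * Few centers close to most of the mass *)

Section Covering.
Variables (R : realType) (n d t : nat) (mu : R) (x : plabel n -> 'rV[R]_d).
Hypothesis t_ge2 : (2 <= t)%N.
Hypothesis feas : feasible t mu x.
Variables (N : nat) (y : 'I_n -> nat -> R) (r : nat) (del eta : R).

Local Notation V := (vtx x).
Local Notation p u := (sqnorm (vtx x u)).
Local Notation dh := (dist2 N y).

Hypothesis dh_tri : forall u v w, dh u w <= dh u v + dh v w.
Hypothesis dh_dist : forall u v, 0 < p u -> dh u v < 1 ->
  p u + p v - 2 * inner (V u) (V v) <= 2 * dh u v * p u.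
Hypothesis del_ge0 : 0 <= del.
Hypothesis del_small : 2 * del < 1.
Hypothesis eta_gt0 : 0 < eta.
Hypothesis r_ge2 : (2 <= r)%N.
Hypothesis r_le : (r <= n)%N.

Definition dh_ball u := [set v | dh u v <= del].
Definition dense := [set u | 4 * n%:R / (3 * r%:R) <= #|dh_ball u|%:R :> R].

(** Three kinds of vertices: one of small norm is close to a single chosen vertex of small norm; a
    dense one has a packing center within 2 del; any other pays its whole shifted norm, where mu <=
    p u / eta. *)
Lemma residual_cover : exists S : {set 'I_n}, #|S| = r /\
  residual_sq (shifted x) S <=
    (4 * del + 2 * eta) * (n%:R * mu) + (1 + eta^-1) * \sum_(u in ~: dense) p u.
Proof.
have n0 : (0 < n)%N by rewrite (leq_trans _ r_le) // (leq_trans _ r_ge2).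
have rp : (0 : R) < r%:R by rewrite ltr0n (leq_trans _ r_ge2).
have np : (0 : R) < n%:R by rewrite ltr0n.
have /andP[m0 m1] := mu_bounds n0 feas.
have lasx : Las t x by case: feas.
have p0 u : 0 <= p u by exact: sqnorm_ge0.
have dle u v : sqnorm (V u - V v) <= p u + p v.
  by rewrite sqnormB lerBlDr lerDl mulr_ge0 // (inner_vtx_ge0 t_ge2 lasx).
have B_refl u : u \in dh_ball u by rewrite inE dist2xx.
have [S0 [S0G S0n S0c]] := maximal_packing dense B_refl.
(* At most 3r/4 centers; the strict inequality leaves room for the vertex of small norm. *)
have S0r : (#|S0| < r)%N.
  have : #|S0|%:R * (4 * n%:R / (3 * r%:R)) <= n%:R :> R.
    apply: (@le_trans _ _ (\sum_(s in S0) #|dh_ball s|%:R)).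
      rewrite mulr_natl -sumr_const; apply: ler_sum => s /(subsetP S0G).
      by rewrite inE.
    by rewrite -natr_sum ler_nat (leq_trans S0n) // card_ord.
  have -> : #|S0|%:R * (4 * n%:R / (3 * r%:R)) = n%:R * (4 * #|S0|%:R / (3 * r%:R)) :> R by ring.
  rewrite -[X in _ <= X]mulr1 ler_pM2l // ler_pdivrMr ?mulr_gt0 // mul1r => h.
  by rewrite -(ltr_nat R); lra.
pose low u := p u <= eta * mu.
have [S1 [S1r S01 S1low]] : exists S1 : {set 'I_n}, [/\ (#|S1| <= r)%N, S0 \subset S1
    & forall u, low u -> exists2 s, s \in S1 & low s].
  have [s ls|none] := pickP low; last first.
    by exists S0; split=> // [|u]; [exact: ltnW | rewrite none].
  exists (s |: S0); split=> [||u _]; last by exists s; rewrite // setU11.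
    by rewrite cardsU1 (leq_trans _ S0r) // -addn1 addnC leq_add2l; case: (_ \in _).
  exact: subsetUr.
have [|S [Sr S1S]] := @superset_of_card _ S1 r; first by rewrite S1r card_ord.
exists S; split=> //.
have etaV : 0 < eta^-1 by rewrite invr_gt0.
have pt u : sqnorm (proj_perp (span_of (shifted x) S) (shifted x u)) <=
    4 * del * p u + 2 * eta * mu + (if u \in ~: dense then (1 + eta^-1) * p u else 0).
  have a1 : 0 <= 4 * del * p u by rewrite !mulr_ge0.
  have a2 : 0 <= 2 * eta * mu by rewrite !mulr_ge0 // ltW.
  have a3 : 0 <= (if u \in ~: dense then (1 + eta^-1) * p u else 0).
    by case: ifP => // _; rewrite mulr_ge0 // addr_ge0 // ltW.
  have [lu|nlu] := boolP (low u).
    have [s sS1 ls] := S1low u lu.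
    apply: le_trans (residual_le_dist feas _ (subsetP S1S _ sS1)) _.
    apply: le_trans (dle _ _) _; move: lu ls; rewrite /low; lra.
  have pu : eta * mu < p u by rewrite ltNge.
  have pu0 : 0 < p u by apply: lt_trans pu; rewrite mulr_gt0.
  rewrite inE in a3 *; have [uG|nG] := boolP (u \in dense); last first.
    apply: le_trans (residual_le_shifted _ _ _) _.
    rewrite (sqnorm_shifted feas).
    have : mu <= eta^-1 * p u by rewrite mulrC ler_pdivlMr // mulrC ltW.
    rewrite /=; nra.
  have [s sS0 [v /andP[]]] := S0c u uG; rewrite !inE => duv dsv.
  have dus : dh u s <= 2 * del.
    apply: le_trans (dh_tri u v s) _; rewrite (dist2C N y v s); lra.
  apply: le_trans (residual_le_dist feas _ (subsetP (subset_trans S01 S1S) _ sS0)) _.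
  rewrite sqnormB; apply: le_trans (dh_dist pu0 (le_lt_trans dus del_small)) _.
  have : dh u s * p u <= 2 * del * p u by apply: ler_wpM2r => //; exact: ltW.
  rewrite /=; lra.
apply: le_trans (ler_sum _ (fun u _ => pt u)) _.
rewrite !big_split /= -mulr_sumr (sum_sqnorm_vtx n0 feas) sumr_const card_ord.
rewrite -big_mkcond /= -mulr_sumr -[X in _ + X + _]mulr_natl; lra.
Qed.

End Covering.

(** 6 <= r^3 for r >= 2; this turns the overlap 1/(6r) into the factor sqrt (log r). *)
Lemma ln_6r_le (R : realType) (r : nat) : (2 <= r)%N -> ln (6 * r%:R) <= 4 * ln r%:R :> R.
Proof.
move=> r2; have r0 : (0 : R) < r%:R by rewrite ltr0n (leq_trans _ r2).
have r2' : (2 : R) <= r%:R by rewrite ler_nat.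
have -> : 4 * ln r%:R = ln (r%:R ^+ 4) :> R by rewrite lnXn // mulr_natl.
rewrite ler_ln ?posrE ?mulr_gt0 ?exprn_gt0 //.
rewrite exprSr ler_pM2r //; nra.
Qed.

Theorem theorem3p1 (R : realType) (eps : R) (eps_gt0 : 0 < eps) :
  exists C : R, 0 < C /\
  forall (n r : nat) (c : 'I_n -> 'I_n -> R)
         (d : nat) (mu : R) (x : plabel n -> 'rV[R]_d),
    regular_capacity c ->
    (2 <= r)%N -> (r <= n)%N ->
    optimal (r + 3) c mu x ->
    (forall A : {set 'I_n}, (0 < #|A| < n)%N ->
       #|A|%:R <= 2%:R * n%:R / r%:R :> R -> 0 < sparsity c A) ->
    (forall A : {set 'I_n}, (0 < #|A| < n)%N ->
       #|A|%:R <= 2%:R * n%:R / r%:R :> R ->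
       C * phi_SDP (r + 3) c * Num.sqrt (ln n%:R * ln r%:R) <= sparsity c A) ->
    exists S : {set 'I_n},
      #|S| = r /\
      residual_sq (shifted x) S <= eps * frob_sq (shifted x).
Proof.
pose e := Num.min eps 1.
have e0 : 0 < e by rewrite lt_min eps_gt0 ltr01.
have e1 : e <= 1 by rewrite ge_min lexx orbT.
have [|| C1 [C10 soft]] := @soft_decomposition R (e / 32); [lra | lra |].
(* With del = e/32 and eta = e/16, 4 del + 2 eta = e/4 and (1 + 1/eta) e2 <= e/4 because e <= 1. The
   sum e/2 suffices since 1 - mu >= 1/2. *)
pose e2 := e ^+ 2 / 68.
have e20 : 0 < e2 by rewrite divr_gt0 // exprn_gt0.
(* 12 = 6 * 2: the 6 is lost in [expand], the 2 comes from counting ordered pairs. The leading 2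
   absorbs the 1 of [Cst], as sq >= 1/2. *)
exists (12 * (2 + 4 * C1) / e2); split.
  by rewrite divr_gt0 // mulr_gt0 //; lra.
move=> n r c d mu x creg r2 rn [feas opt] pos big.
have [cC c0 _] := creg.
have n2 : (2 <= n)%N by exact: leq_trans rn.
have n0 : (0 < n)%N by exact: leq_trans n2.
have t2 : (2 <= r + 3)%N by rewrite addn3.
have lasx : Las (r + 3) x by case: feas.
have rp : (0 : R) < r%:R by rewrite ltr0n (leq_trans _ r2).
have np : (0 : R) < n%:R by rewrite ltr0n.
have /andP[m0 m1] := mu_bounds n0 feas.
have k_ge0 u v := inner_vtx_ge0 t2 lasx u v.
have k_le u v := inner_vtx_le t2 lasx u v.
have k_tri u v w := inner_vtx_tri t2 lasx u v w.
have [N [y [tri y1 ylip ydist]]] := normalized_vectors k_ge0 k_le k_tri.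
have [S [Sr Sle]] := residual_cover (eta := e / 16) (del := e / 32) t2 feas tri ydist
  (ltW (divr_gt0 e0 (ltr0Sn R 31))) ltac:(lra) (divr_gt0 e0 (ltr0Sn R 15)) r2 rn.
exists S; split=> //.
rewrite (frob_shifted n0 feas).
have nm0 : 0 < n%:R * mu by rewrite mulr_gt0.
set bad := ~: _ in Sle.
have [few|many] := lerP (\sum_(u in bad) sqnorm (vtx x u)) (e2 * (n%:R * mu)).
  apply: (@le_trans _ _ (e * (n%:R * mu * (1 - mu)))); last first.
    by rewrite ler_wpM2r ?ge_min ?lexx // mulr_ge0 ?(ltW nm0) //; lra.
  apply: (le_trans Sle).
  have h1 : (1 + (e / 16)^-1) * (e2 * (n%:R * mu)) <= e / 4 * (n%:R * mu).
    have -> : (1 + (e / 16)^-1) * (e2 * (n%:R * mu)) = ((e ^+ 2 + 16 * e) / 68) * (n%:R * mu).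
      by rewrite /e2; field; rewrite gt_eqF.
    by rewrite ler_wpM2r ?(ltW nm0) //; nra.
  have h2 : (1 + (e / 16)^-1) * \sum_(u in bad) sqnorm (vtx x u) <=
      (1 + (e / 16)^-1) * (e2 * (n%:R * mu)).
    by apply: ler_wpM2l few; rewrite addr_ge0 // invr_ge0; lra.
  have h3 : e * (n%:R * mu) * (1 / 2) <= e * (n%:R * mu) * (1 - mu).
    by apply: ler_wpM2l; [rewrite mulr_ge0 // ltW | lra].
  lra.
exfalso.
pose phi := objective c mu x.
pose sq := Num.sqrt (ln n%:R * ln r%:R) : R.
have lnn := ln_nat_ge_half R n2; have lnr := ln_nat_ge_half R r2.
have sq_half : 1 / 2 <= sq.
  by rewrite -(@ler_pXn2r _ 2) ?nnegrE ?sqrtr_ge0 ?divr_ge0 // /sq sqr_sqrtr; nra.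
pose L := ln (6 * r%:R) : R.
have L0 : 0 < L.
  have r2' : (2 : R) <= r%:R by rewrite ler_nat.
  by rewrite ln_gt0 //; lra.
have expL : expR (- L) = (6 * r%:R)^-1 by rewrite expRN lnK // posrE mulr_gt0.
have sqL : Num.sqrt (ln n%:R * L) <= 2 * sq.
  have -> : 2 * sq = Num.sqrt (4 * (ln n%:R * ln r%:R)).
    rewrite sqrtrM // (_ : 4 = 2 ^+ 2); last by ring.
    by rewrite sqrtr_sqr ger0_norm.
  apply: ler_wsqrtr; rewrite mulrCA; apply: ler_wpM2l; first lra.
  exact: ln_6r_le.
have [|Z [g [g0 gsum glip gfar]]] := soft _ N y L _ tri y1 L0; first by rewrite card_ord.
rewrite card_ord in glip.
pose Cst := 1 + 4 * C1 * sq.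
have dist0 u v : 0 <= sqnorm (vtx x u - vtx x v) by exact: sqnorm_ge0.
have lip u v : `|sqnorm (vtx x u) - sqnorm (vtx x v)| +
    Num.min (sqnorm (vtx x u)) (sqnorm (vtx x v)) * \sum_z `|g z u - g z v| <=
    Cst * sqnorm (vtx x u - vtx x v).
  rewrite /Cst mulrDl mul1r; apply: lerD.
    rewrite sqnormB ler_norml; have := k_le u v; have := k_le v u.
    by rewrite (innerC (vtx x v)) /sqnorm; lra.
  have min0 : 0 <= Num.min (sqnorm (vtx x u)) (sqnorm (vtx x v)).
    by rewrite le_min !sqnorm_ge0.
  apply: le_trans (ler_wpM2l min0 (glip u v)) _.
  rewrite mulrCA; have := ylip u v; rewrite -sqnormB.
  set md := Num.min _ _ * _; set D := sqnorm (_ - _) => mdD.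
  have md0 : 0 <= md by rewrite mulr_ge0 // dist2_ge0.
  apply: (@le_trans _ _ (C1 * (2 * sq) * md)).
    by apply: ler_wpM2r => //; apply: ler_wpM2l => //; exact: ltW.
  have -> : 4 * C1 * sq * D = C1 * (2 * sq) * (2 * D) by ring.
  by apply: ler_wpM2l => //; rewrite !mulr_ge0 ?sqrtr_ge0 // ltW.
pose small (A : {set 'I_n}) := (A != set0) && (#|A|%:R <= 5 * n%:R / (3 * r%:R) :> R).
have smallP A : small A -> (0 < #|A| < n)%N /\ #|A|%:R <= 2%:R * n%:R / r%:R :> R.
  case/andP; rewrite -card_gt0 => A0 An; split.
    rewrite A0 /= -(ltr_nat R); apply: (le_lt_trans An).
    rewrite ltr_pdivrMr ?mulr_gt0 // mulrC ltr_pM2l //.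
    by have : (2 : R) <= r%:R; [rewrite ler_nat | lra].
  apply: (le_trans An); rewrite ler_pdivrMr ?mulr_gt0 //.
  have -> : 2 * n%:R / r%:R * (3 * r%:R) = 6 * n%:R :> R by field; rewrite gt_eqF.
  by rewrite ler_pM2r //; lra.
pose C0 := 12 * (2 + 4 * C1) / e2.
have phi0 : 0 <= phi.
  apply: mulr_ge0.
    by rewrite invr_ge0; apply: mulr_ge0; [exact: ltW | lra].
  by apply: sumr_ge0 => u _; apply: sumr_ge0 => v _; rewrite mulr_ge0.
have sq0 : 0 <= sq by exact: sqrtr_ge0.
have C00 : 0 <= C0 * phi * sq.
  apply: mulr_ge0 => //; apply: mulr_ge0 => //.
  by apply: divr_ge0; [apply: mulr_ge0; lra | exact: ltW].
(* The sparsity bound says nothing when phi = 0, so the expansion is taken as the least actual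
   sparsity, which is positive. The + 1 keeps the default positive if no set is small. *)
pose K := \big[Num.min/C0 * phi * sq + 1]_(A | small A) sparsity c A.
have K0 : 0 < K.
  apply/bigmin_gtP; split=> [|A sA]; first lra.
  by have [h1 h2] := smallP A sA; exact: pos.
have Kbig : C0 * phi * sq <= K.
  apply/bigmin_geP; split=> [|A sA]; first lra.
  have [h1 h2] := smallP A sA; rewrite /phi opt; exact: big.
(* As r >= 2, a small set has at most 5n/6 vertices, so the factor (n - |A|) / n in the sparsity is
   at least 1/6. *)
have expand (A : {set 'I_n}) : A != set0 -> #|A|%:R <= 5 * n%:R / (3 * r%:R) :> R ->
    K / 6 * #|A|%:R <= edge_weight c A (~: A).
  move=> A0 An; have sA : small A by rewrite /small A0.
  have [/andP[Ap Alt] _] := smallP A sA.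
  have Ap' : (0 : R) < #|A|%:R by rewrite ltr0n.
  have An' : #|A|%:R < n%:R :> R by rewrite ltr_nat.
  have : K <= sparsity c A by exact: bigmin_le_cond.
  rewrite /sparsity ler_pdivlMr ?mulr_gt0 ?subr_gt0 // => h.
  rewrite -(@ler_pM2l _ n%:R) //; apply: le_trans h.
  have -> : n%:R * (K / 6 * #|A|%:R) = K * (#|A|%:R * (n%:R / 6)) by ring.
  rewrite ler_pM2l // ler_pM2l //.
  suff : #|A|%:R <= 5 / 6 * n%:R :> R by lra.
  apply: (le_trans An); rewrite ler_pdivrMr ?mulr_gt0 //.
  have -> : 5 / 6 * n%:R * (3 * r%:R) = 5 * n%:R * (r%:R / 2) :> R by field.
  by rewrite ler_peMr ?mulr_ge0 // ler_pdivlMr // mul1r ler_nat.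
have := bad_mass_le cC c0 (ltW (divr_gt0 K0 (ltr0Sn R 5))) expand n0 r2 erefl
  (B := dh_ball N y (e / 32)) (bad := bad) _ (fun u => sqnorm_ge0 (vtx x u)) g0 gsum lip.
rewrite (sum_capacity_dist n0 feas creg) -/phi => h.
have {}h : K / 6 * \sum_(u in bad) sqnorm (vtx x u) <=
    Cst * (2 * phi * (n%:R * mu * (1 - mu))).
  apply: h => [u|u v]; first by rewrite !inE -ltNge => /ltW.
  by rewrite inE -ltNge -expL; exact: gfar.
have h1 : K / 6 * (e2 * (n%:R * mu)) < K / 6 * \sum_(u in bad) sqnorm (vtx x u).
  by rewrite ltr_pM2l // divr_gt0.
have CstP : 0 <= Cst * (2 * phi).
  apply: mulr_ge0; last exact: mulr_ge0.
  by apply: addr_ge0 => //; rewrite !mulr_ge0 // ltW.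
have h2 : Cst * (2 * phi * (n%:R * mu * (1 - mu))) <= Cst * (2 * phi) * (n%:R * mu).
  have -> : Cst * (2 * phi * (n%:R * mu * (1 - mu))) = Cst * (2 * phi) * (n%:R * mu) * (1 - mu).
    by ring.
  by apply: ler_piMr; [apply: mulr_ge0 => //; exact: ltW | lra].
have h3 : K / 6 * e2 < Cst * (2 * phi).
  rewrite -(@ltr_pM2r _ (n%:R * mu)) //.
  have -> : K / 6 * e2 * (n%:R * mu) = K / 6 * (e2 * (n%:R * mu)) by ring.
  exact: lt_le_trans h1 (le_trans h h2).
have h4 : C0 * phi * sq / 6 * e2 <= K / 6 * e2.
  by rewrite ler_pM2r // ler_pM2r // invr_gt0.
have h5 : C0 * phi * sq / 6 * e2 = (2 + 4 * C1) * sq * (2 * phi).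
  by rewrite /C0; field; rewrite gt_eqF.
have h6 : Cst * (2 * phi) <= (2 + 4 * C1) * sq * (2 * phi).
  apply: ler_wpM2r; first exact: mulr_ge0.
  by rewrite /Cst mulrDl; lra.
lra.
Qed.
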